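(* Let $\mathfrak{g}$ be a finite-dimensional complex reductive Lie algebra and let $\mathfrak{l}$ be the Levi subalgebra of a standard parabolic subalgebra of $\mathfrak{g}$. With the notation of the context, the relative extremal projector $P_{\mathfrak{g},\mathfrak{l}}:M\to M$ can be expanded, as an operator on $M$, as $$P_{\mathfrak{g},\mathfrak{l}}=1+\sum_{\ell=1}^{\infty}\ \sum_{(\beta_1,\ldots,\beta_\ell)\in(\Delta_+)^\ell}P_{\mathfrak{g},\mathfrak{l}}(\beta_1,\ldots,\beta_\ell)\,f_{\beta_1}f_{\beta_2}\cdots f_{\beta_\ell}\,e_{\beta_\ell}\cdots e_{\beta_2}e_{\beta_1},$$ where the coefficients $P_{\mathfrak{g},\mathfrak{l}}(\beta_1,\ldots,\beta_\ell)\in U'(\mathfrak{h})$, for $\ell\ge 1$ and $\beta_1,\ldots,\beta_\ell\in Q_{\succ 0}$, are determined recursively by $$P_{\mathfrak{g},\mathfrak{l}}(\beta)=\big(-1+\delta_{\beta\in Q_+(\mathfrak{l})}\big)\psi_{\beta}\qquad(\beta\in Q_{\succ 0})$$ and, for $\ell\ge 2$, $$P_{\mathfrak{g},\mathfrak{l}}(\beta_1,\ldots,\beta_\ell)=-\psi_{\beta_1}P_{\mathfrak{g},\mathfrak{l}}(\beta_1+\beta_2,\beta_3,\ldots,\beta_\ell)+\delta_{\beta_1\in Q_+(\mathfrak{l})}\,\psi_{\beta_1}\,P_{\mathfrak{g},\mathfrak{l}}(\beta_2,\beta_3,\ldots,\beta_\ell)^{\beta_1}.$$ Moreover, if all $\beta_i$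 belong to $Q_+(\mathfrak{l})$, then $P_{\mathfrak{g},\mathfrak{l}}(\beta_1,\ldots,\beta_\ell)=0$. If at least one $\beta_i$ is not in $Q_+(\mathfrak{l})$, then, letting $m=\min\{i\mid \beta_i\notin Q_+(\mathfrak{l})\}$, $$P_{\mathfrak{g},\mathfrak{l}}(\beta_1,\ldots,\beta_\ell)=\sum_{k=0}^{m-1}(-1)^{\ell-k}\Big(\psi_{\beta_1+\cdots+\beta_k}\,\psi_{\beta_2+\cdots+\beta_k}^{\beta_1}\cdots\psi_{\beta_k}^{\beta_1+\cdots+\beta_{k-1}}\cdot\psi_{\beta_{k+1}}^{\beta_1+\cdots+\beta_k}\,\psi_{\beta_{k+1}+\beta_{k+2}}^{\beta_1+\cdots+\beta_k}\cdots\psi_{\beta_{k+1}+\cdots+\beta_\ell}^{\beta_1+\cdots+\beta_k}\Big).$$ (For $k=0$ the first group of factors is the empty product, equal to $1$.)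
   Context: Choose: a non-degenerate invariant symmetric bilinear form $(\cdot,\cdot)$ on $\mathfrak{g}$; a Cartan subalgebra $\mathfrak{h}$; a set $\Delta_+$ of positive roots (so the root system is $\Delta=\Delta_+\sqcup(-\Delta_+)$ and $(\Delta_++\Delta_+)\cap\Delta\subseteq\Delta_+$). This gives $\mathfrak{g}=\mathfrak{g}_-\oplus\mathfrak{h}\oplus\mathfrak{g}_+$ with $\mathfrak{g}_{\pm}$ the sum of the root spaces for $\pm\Delta_+$. For each $\beta\in\Delta_+$ choose a nonzero root vector $e_\beta\in\mathfrak{g}_\beta$, and let $f_\beta\in\mathfrak{g}_{-\beta}$ be the unique vector with $(e_\beta,f_\beta)=1$. For $\lambda\in\mathfrak{h}^\ast$ let $h_\lambda\in\mathfrak{h}$ be defined by $(h_\lambda,a)=\lambda(a)$ for all $a\in\mathfrak{h}$, and put $(\lambda,\mu)=(h_\lambda,h_\mu)$ for $\lambda,\mu\in\mathfrak{h}^\ast$. Let $\rho=\frac12\sum_{\beta\in\Delta_+}\beta$. Let $Q_+=\mathbb{Z}_{\ge0}\Delta_+\subseteq\mathfrak{h}^\ast$ and $Q_{\succ0}=Q_+\setminus\{0\}$. The Levi subalgebra $\mathfrak{l}$ corresponds to a subset $\Pi(\mathfrak{l})$ of the simple roots: $\Delta_+(\mathfrak{l})=\Delta_+\cap\mathbb{Z}_{\ge0}\Pi(\mathfrak{l})$ and $\mathfrak{l}$ is the span of $\mathfrak{h}$ and all $e_\beta,f_\beta$ with $\beta\in\Delta_+(\mathfrak{l})$. The Levi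 cone is $Q_+(\mathfrak{l})=\mathbb{Z}_{\ge0}\Delta_+(\mathfrak{l})$. The symbol $\delta_{\beta\in Q_+(\mathfrak{l})}$ is $1$ if $\beta\in Q_+(\mathfrak{l})$ and $0$ otherwise. Let $S=U(\mathfrak{h})\setminus\{0\}$, $U'(\mathfrak{g})=S^{-1}U(\mathfrak{g})$ (Ore localization), and let $U'(\mathfrak{h})\subseteq U'(\mathfrak{g})$ be the fraction field of $U(\mathfrak{h})$. For $\lambda\in\mathfrak{h}^\ast$, $\phi\mapsto\phi^\lambda$ denotes the $\mathbb{C}$-algebra automorphism of $U'(\mathfrak{h})$ determined by $h^\lambda=h+\lambda(h)$ for $h\in\mathfrak{h}$. For $\lambda\in Q_{\succ0}$ put $$\psi_\lambda=\frac{1}{h_\lambda+(\rho,\lambda)+\frac12(\lambda,\lambda)}\in U'(\mathfrak{h}),$$ and $\psi_\lambda^\mu=(\psi_\lambda)^\mu$. The localized universal Verma module is $M=U'(\mathfrak{g})/U'(\mathfrak{g})\mathfrak{g}_+$, a $(U'(\mathfrak{g}),U'(\mathfrak{h}))$-bimodule. With the adjoint action $h\cdot m=hm-mh$ one has $M=\bigoplus_{\lambda\in Q_+}M_{-\lambda}$, where $M_{-\lambda}=\{m\in M\mid h\cdot m=-\lambda(h)m\ \forall h\in\mathfrak{h}\}$. The relative extremal projector $P_{\mathfrak{g},\mathfrak{l}}:M\to M$ is the linear operator that is the identity on $M_{-\lambda}$ for $\lambda\in Q_+(\mathfrak{l})$ and zero on $M_{-\lambda}$ for $\lambda\in Q_+\setminus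 Q_+(\mathfrak{l})$. Elements of $U'(\mathfrak{g})$ act on $M$ by left multiplication, and infinite sums of operators on $M$ are understood pointwise (on each vector only finitely many terms are nonzero). *)

(* Defs.v *)
From HB Require Import structures.
From mathcomp Require Import all_boot all_order all_algebra.
From mathcomp Require Import sesquilinear.
From mathcomp Require Export finmap boolp reals complex.

Set Implicit Arguments.
Unset Strict Implicit.
Unset Printing Implicit Defensive.

Import GRing.Theory.
Local Open Scope ring_scope.

Section LieAlgebra.
Variables (K : fieldType) (g : vectType K) (lie : {bilinear g -> g -> g}).

Record is_lie_bracket : Prop := {
  lie_alternating : forall x, lie x x = 0;
  lie_jacobi : forall x y z,
    lie x (lie y z) + lie y (lie z x) + lie z (lie x y) = 0 }.

Definition lie_ideal (I : {vspace g}) : Prop :=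
  forall x y, y \in I -> lie x y \in I.

(* Every ideal has a complementary ideal, i.e., the adjoint representation is
   completely reducible. *)
Definition reductive : Prop :=
  forall I : {vspace g}, lie_ideal I ->
    exists J : {vspace g},
      [/\ lie_ideal J, (I + J)%VS = fullv & (I :&: J)%VS = 0%VS].

Definition ad_semisimple (x : g) : Prop :=
  exists2 X : seq g, basis_of fullv X &
    forall y, y \in X -> exists c : K, lie x y = c *: y.

(* Cartan subalgebras of a reductive Lie algebra: toral subalgebras (commutative
   and made of semisimple elements) equal to their own centralizer. *)
Record cartan_subalgebra (h : {vspace g}) : Prop := {
  cartan_abelian : forall x y, x \in h -> y \in h -> lie x y = 0;
  cartan_semisimple : forall x, x \in h -> ad_semisimple x;
  cartan_self_centralizing :
    forall x, (forall y, y \in h -> lie y x = 0) -> x \in h }.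

Record invariant_nondegenerate (B : {symmetric g}) : Prop := {
  form_invariant : forall x y z, B (lie x y) z = B x (lie y z);
  form_nondegenerate : forall x, (forall y, B x y = 0) -> x = 0 }.

End LieAlgebra.

Notation weight h := 'Hom(subvs_of h, _^o).

Definition nat_cone (V : zmodType) (A : {fset V}) (v : V) : Prop :=
  exists c : V -> nat, v = \sum_(a <- A) a *+ c a.

Definition nat_cone_pos (V : zmodType) (A : {fset V}) (v : V) : Prop :=
  nat_cone A v /\ v <> 0.

Section Roots.
Variables (K : fieldType) (g : vectType K) (lie : {bilinear g -> g -> g}).
Variables (B : {symmetric g}) (h : {vspace g}).
Local Notation wt := ('Hom(subvs_of h, K^o)).

Definition root_space (al : wt) (x : g) : Prop :=
  forall a : subvs_of h, lie (vsval a) x = (al a : K) *: x.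

Definition is_root (al : wt) : Prop :=
  al <> 0 /\ exists2 x, root_space al x & x <> 0.

Record positive_system (Dp : {fset wt}) : Prop := {
  pos_cover : forall al, is_root al <-> (al \in Dp \/ - al \in Dp);
  pos_disjoint : forall al, al \in Dp -> - al \notin Dp;
  pos_add : forall al be, al \in Dp -> be \in Dp ->
    is_root (al + be) -> al + be \in Dp }.

Variable Dp : {fset wt}.

Definition positive_part (x : g) : Prop :=
  exists2 c : wt -> g, (forall be, be \in Dp -> root_space be (c be)) &
    x = \sum_(be <- Dp) c be.

Record root_vectors (e f : wt -> g) : Prop := {
  e_root : forall be, be \in Dp -> root_space be (e be) /\ e be <> 0;
  f_root : forall be, be \in Dp -> root_space (- be) (f be);
  ef_pairing : forall be, be \in Dp -> B (e be) (f be) = 1 }.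

Definition is_coroot_map (hv : wt -> subvs_of h) : Prop :=
  forall (la : wt) (a : subvs_of h), B (vsval (hv la)) (vsval a) = la a.

Definition weight_form (hv : wt -> subvs_of h) (la mu : wt) : K :=
  B (vsval (hv la)) (vsval (hv mu)).

Definition half_sum : wt := (2^-1 : K) *: \sum_(be <- Dp) be.

Definition simple_root (al : wt) : Prop :=
  al \in Dp /\
  ~ (exists be ga, [/\ be \in Dp, ga \in Dp & al = be + ga]).

Definition levi_roots (Pil : {fset wt}) : {fset wt} :=
  [fset be in Dp | `[< nat_cone Pil be >]]%fset.

Definition levi_subalgebra (e f : wt -> g) (Pil : {fset wt}) : {vspace g} :=
  (h + <<[seq e be | be <- levi_roots Pil]>>
     + <<[seq f be | be <- levi_roots Pil]>>)%VS.

End Roots.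

Section Enveloping.
Variables (K : fieldType) (g : vectType K) (lie : {bilinear g -> g -> g}).

Definition lie_to_alg (A : algType K) (f : {linear g -> A}) : Prop :=
  forall x y, f (lie x y) = f x * f y - f y * f x.

Record enveloping_algebra (U : algType K) (iota : {linear g -> U}) : Prop := {
  env_lie : lie_to_alg iota;
  env_ex : forall (A : algType K) (f : {linear g -> A}), lie_to_alg f ->
    exists F : {lrmorphism U -> A}, forall x, F (iota x) = f x;
  env_uniq : forall (A : algType K) (F G : {lrmorphism U -> A}),
    (forall x, F (iota x) = G (iota x)) -> forall u, F u = G u }.

Variables (h : {vspace g}) (U : algType K) (iota : {linear g -> U}).

(* U(h) as a subalgebra of U(g): the subalgebra generated by h. *)
Inductive in_Uh : U -> Prop :=
| Uh_gen (a : subvs_of h) : in_Uh (iota (vsval a))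
| Uh_scalar (c : K) : in_Uh c%:A
| Uh_add u v : in_Uh u -> in_Uh v -> in_Uh (u + v)
| Uh_mul u v : in_Uh u -> in_Uh v -> in_Uh (u * v).

Definition in_S (s : U) : Prop := in_Uh s /\ s <> 0.

End Enveloping.

(* j exhibits U' as the left ring of fractions S^-1 U. The use of unitAlgType
   is no restriction: it only fixes a total inverse x^-1 (with x^-1 = x when x
   is not a unit). *)
Record ore_localization (K : fieldType) (U : algType K) (S : U -> Prop)
    (U' : unitAlgType K) (j : {lrmorphism U -> U'}) : Prop := {
  loc_unit : forall s, S s -> j s \is a GRing.unit;
  loc_frac : forall x : U', exists s u, S s /\ x = (j s)^-1 * j u;
  loc_ker : forall u, j u = 0 <-> exists2 s, S s & s * u = 0 }.

Section Localized.
Variables (K : fieldType) (g : vectType K) (lie : {bilinear g -> g -> g}).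
Variables (B : {symmetric g}) (h : {vspace g}).
Local Notation wt := ('Hom(subvs_of h, K^o)).
Variables (U : algType K) (iota : {linear g -> U}).
Variables (U' : unitAlgType K) (j : {lrmorphism U -> U'}).

Definition in_U'h (x : U') : Prop :=
  exists s u, [/\ in_S h iota s, in_Uh h iota u & x = (j s)^-1 * j u].

(* sigma restricts to the K-algebra automorphism phi |-> phi^la of U'(h); its
   values outside U'(h) are irrelevant. *)
Record is_shift (la : wt) (sigma : U' -> U') : Prop := {
  shift_stable : forall x, in_U'h x -> in_U'h (sigma x);
  shift_inj : forall x y, in_U'h x -> in_U'h y -> sigma x = sigma y -> x = y;
  shift_surj : forall y, in_U'h y -> exists2 x, in_U'h x & sigma x = y;
  shift_one : sigma 1 = 1;
  shift_add : forall x y, in_U'h x -> in_U'h y ->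
    sigma (x + y) = sigma x + sigma y;
  shift_mul : forall x y, in_U'h x -> in_U'h y ->
    sigma (x * y) = sigma x * sigma y;
  shift_scale : forall (c : K) x, in_U'h x -> sigma (c *: x) = c *: sigma x;
  shift_gen : forall a : subvs_of h,
    sigma (j (iota (vsval a))) = j (iota (vsval a)) + (la a : K)%:A }.

Definition psi (Dp : {fset wt}) (hv : wt -> subvs_of h) (la : wt) : U' :=
  (j (iota (vsval (hv la)))
   + (weight_form B hv (half_sum Dp) la
      + 2^-1 * weight_form B hv la la)%:A)^-1.

Definition in_left_ideal (Dp : {fset wt}) (u : U') : Prop :=
  exists2 s : seq (U' * g),
    (forall p, p \in s -> positive_part lie Dp p.2) &
    u = \sum_(p <- s) p.1 * j (iota p.2).

(* M is the left U'-module U' / U' g_+, with vac the class of 1, and ract is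
   the right action of U'(h) on it; ract m x is irrelevant for x outside
   U'(h). *)
Record universal_verma (Dp : {fset wt})
    (M : lmodType U') (vac : M) (ract : M -> U' -> M) : Prop := {
  verma_cyclic : forall m, exists u : U', m = u *: vac;
  verma_ann : forall u : U', u *: vac = 0 <-> in_left_ideal Dp u;
  verma_ract : forall (u x : U'), in_U'h x ->
    ract (u *: vac) x = (u * x) *: vac }.

Variables (M : lmodType U') (ract : M -> U' -> M).

Definition adjoint_weight_space (mu : wt) (m : M) : Prop :=
  forall a : subvs_of h,
    j (iota (vsval a)) *: m - ract m (j (iota (vsval a)))
    = (mu a : K)%:A *: m.

Record relative_extremal_projector (Dp Dpl : {fset wt}) (P : M -> M) : Prop := {
  proj_add : forall m n, P (m + n) = P m + P n;
  proj_scale : forall (c : K) m, P (c%:A *: m) = c%:A *: P m;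
  proj_id : forall la m, nat_cone Dpl la ->
    adjoint_weight_space (- la) m -> P m = m;
  proj_zero : forall la m, nat_cone Dp la -> ~ nat_cone Dpl la ->
    adjoint_weight_space (- la) m -> P m = 0 }.

End Localized.

Section Coefficients.
Variables (V : zmodType) (A : nzRingType) (Dpl : {fset V}).
Variables (psi : V -> A) (shift : V -> A -> A).

Definition delta_cone (be : V) : A := `[< nat_cone Dpl be >]%:R.

Fixpoint proj_coef_rec (be : V) (s : seq V) : A :=
  if s is be2 :: s' then
    - psi be * proj_coef_rec (be + be2) s'
    + delta_cone be * psi be * shift be (proj_coef_rec be2 s')
  else (- 1 + delta_cone be) * psi be.

(* P(s) for a nonempty sequence s; the value at [::] is never used. *)
Definition proj_coef (s : seq V) : A :=
  if s is be :: s' then proj_coef_rec be s' else 1.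

(* s`_i + ... + s`_(k-1), with indices starting from 0. *)
Definition seg_sum (s : seq V) (i k : nat) : V := \sum_(i <= t < k) s`_t.

Definition closed_term (s : seq V) (k : nat) : A :=
  (- 1) ^+ (size s - k) *
  ((\prod_(0 <= i < k) shift (seg_sum s 0 i) (psi (seg_sum s i k))) *
   (\prod_(k <= i < size s) shift (seg_sum s 0 k) (psi (seg_sum s k i.+1)))).

End Coefficients.

(* f_(b_1) ... f_(b_l) e_(b_l) ... e_(b_1) *)
Definition fe_word (I : Type) (A : nzRingType) (e f : I -> A) (s : seq I) : A :=
  (\prod_(b <- s) f b) * (\prod_(b <- rev s) e b).

(* Main.v *)
Require Import Defs.
From HB Require Import structures.
From mathcomp Require Import all_boot all_order all_algebra.
From mathcomp Require Import sesquilinear.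
From mathcomp Require Import ring zify.

Set Implicit Arguments.
Unset Strict Implicit.
Unset Printing Implicit Defensive.

Import Order.TTheory GRing.Theory Num.Theory VectorInternalTheory.
Local Open Scope ring_scope.

(** Let [D la = h_la + (rho, la) + (la, la) / 2], the inverse of [psi la].

    The theorem rests on one computation with the Casimir element. Write
    [Omega] for the sum of the operators [f_b e_b] over the positive roots [b].
    The Casimir is central, so on [u vac] it acts through its value on [vac],
    an element of [U'(h)] multiplied on the right of [u]; moving that element
    to the left of a vector of weight [- la] shifts it by [la]. Comparing the
    two expressions shows that [Omega] acts on [M_{- la}] as left multiplication
    by [D la] ([omega_piece]). Hence the identity of [M_{- la}] is [psi la Omega]
    for [la <> 0], and [P - 1] acts there as [(delta_la - 1) psi la Omega], where
    [delta_la] is 1 or 0 according to whether [la] lies in the Levi cone.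

    The recursion for the coefficients turns this into the expansion. For a
    fixed weight [be], consider the sum over all words [b_2 ... b_l] of
    [P(be, b_2, ..., b_l)^{- be} f_{b_2} ... f_{b_l} e_{b_l} ... e_{b_2}]. On
    [M_{- mu}] it equals [(delta_{be + mu} - 1) psi_{be + mu}^{- be}]
    ([word_sum_piece]): this follows by induction, peeling off [b_2], from
    [Omega = D mu] on [M_{- mu}], from [delta_{be + mu} = delta_be delta_mu], and
    from the partial fraction identity behind
    [D (be + mu)^{- be} = (D be)^{- be} + D mu]. Pulling the first letter of each
    word out of the expansion of [P - 1] then leaves
    [(delta_la - 1) psi la Omega], which is [delta_la - 1] ([expansion_piece]).

    The closed formula ([coef_closed]) is an induction along the same recursion;
    the terms of the two halves combine in pairs by
    [psi_{b + c} psi_c^b = psi_b (psi_c^b - psi_{b + c})] ([psi_split]).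

    Three facts on root systems enter: the Levi cone is a face of the cone of
    positive roots ([levi_cone_face], which is [delta_{be + mu} = delta_be delta_mu]);
    a weight can be lowered only finitely often inside the cone
    ([nat_cone_bound]), which makes the sum finite on each vector; and no nonzero
    weight of the cone is orthogonal to all roots ([nat_cone_pos_pairing]), which
    makes [D la] invertible ([dpsi_unit]). They are derived from strings of
    root vectors: these give the integrality and the sign rules of the pairings
    [2 (la, al) / (al, al)], and with them a reflection-invariant positive form
    ([qform]). The multiplicity one of the roots ([root_space_line]) makes the
    Casimir equal to [2 Omega] plus a Cartan part. *)

(** * Partial fractions, tuples and cones *)

Lemma inv_sum_split (R : unitRingType) (a b d : R) :
  a \is a GRing.unit -> b \is a GRing.unit -> d \is a GRing.unit ->
  GRing.comm d b -> a = d + b -> a^-1 * b^-1 = d^-1 * (b^-1 - a^-1).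
Proof.
move=> ua ub ud dbC aE; have baC : b * a^-1 = a^-1 * b.
  by apply: commrV; rewrite aE; apply: commrD => //; exact: commr_sym.
have dE : d = a - b by rewrite aE addrK.
rewrite -[LHS](mulKr ud); congr (_ * _).
by rewrite {1}dE mulrBl mulVKr // !mulrA baC mulrK.
Qed.

Lemma inv_diff_cancel (R : unitRingType) (a d : R) :
  a \is a GRing.unit -> d \is a GRing.unit -> GRing.comm d a ->
  d^-1 * a^-1 * (a - d) = d^-1 - a^-1.
Proof.
move=> ua ud daC; rewrite mulrBr mulrVK //; congr (_ - _).
have -> : d^-1 * a^-1 = a^-1 * d^-1 by rewrite -!invrM ?daC.
by rewrite mulrVK.
Qed.

Lemma big_tuple_cons (T : finType) (W : nmodType) n (F : n.+1.-tuple T -> W) :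
  \sum_t F t = \sum_x \sum_(t : n.-tuple T) F [tuple of x :: t].
Proof.
rewrite pair_big /= (reindex (fun p : T * n.-tuple T => [tuple of p.1 :: p.2])) //=.
exists (fun t => (thead t, [tuple of behead t])) => [[x t] _|t _] /=.
  by congr (_, _); apply: val_inj.
by rewrite [RHS]tuple_eta.
Qed.

Section NatCone.
Variables (V : zmodType) (A : {fset V}).

Lemma nat_cone0 : nat_cone A 0.
Proof. by exists (fun=> 0%N); rewrite big1. Qed.

Lemma nat_coneD u v : nat_cone A u -> nat_cone A v -> nat_cone A (u + v).
Proof.
move=> [c ->] [d ->]; exists (fun a => c a + d a)%N.
by rewrite -big_split; apply: eq_bigr => a _; rewrite mulrnDr.
Qed.

Lemma nat_cone_mem a : a \in A -> nat_cone A a.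
Proof.
move=> aA; exists (fun b => b == a : nat).
rewrite (big_rem _ aA) /= eqxx mulr1n big_seq big1 ?addr0 // => b.
by rewrite (mem_rem_uniq _ (fset_uniq A)) inE => /andP[/negPf->].
Qed.

Lemma nat_cone_sum (s : seq V) :
  (forall a, a \in s -> nat_cone A a) -> nat_cone A (\sum_(a <- s) a).
Proof.
elim: s => [|a s IH] sA; first by rewrite big_nil; exact: nat_cone0.
rewrite big_cons; apply: nat_coneD; first by apply: sA; rewrite mem_head.
by apply: IH => b bs; apply: sA; rewrite inE bs orbT.
Qed.

Lemma nat_coneP v :
  nat_cone A v <-> exists2 s : seq V, {subset s <= A} & v = \sum_(a <- s) a.
Proof.
split=> [[c ->]|[s sA ->]]; last by apply: nat_cone_sum => a /sA/nat_cone_mem.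
exists (flatten [seq nseq (c a) a | a <- A]).
  by move=> b /flattenP[_ /mapP[a aA ->]] /nseqP[->].
by rewrite big_flatten big_map; apply: eq_bigr => a _; rewrite big_nseq -Monoid.iteropE.
Qed.

End NatCone.

(** * The weight decomposition for a Cartan subalgebra *)

Section CartanDecomposition.
Variables (K : fieldType) (g : vectType K) (lie : {bilinear g -> g -> g}).
Hypothesis lieP : is_lie_bracket lie.

Lemma lie_skew x y : lie x y = - lie y x.
Proof.
have := lie_alternating lieP (x + y).
rewrite linearDl /= !linearDr /= !(lie_alternating lieP) add0r addr0.
by move/eqP; rewrite addr_eq0 => /eqP.
Qed.

Lemma lie_derivation x y z :
  lie x (lie y z) = lie (lie x y) z + lie y (lie x z).
Proof.
have := lie_jacobi lieP x y z.
rewrite (lie_skew z (lie x y)) (lie_skew z x) linearNr /=.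
by rewrite -addrA -opprD => /subr0_eq ->; rewrite addrC.
Qed.

Variable h : {vspace g}.
Hypothesis h_cartan : cartan_subalgebra lie h.
Local Notation wt := ('Hom(subvs_of h, K^o)).

Local Notation n := (dim g).

Let ad_mx (a : g) : 'M[K]_n := lin1_mx (v2r \o lie a \o r2v).

Lemma row_ad_mx a v : v *m ad_mx a = v2r (lie a (r2v v)).
Proof. by rewrite mul_rV_lin1. Qed.

Lemma diagonalizable_ad a : a \in h ->
  exists2 P : 'M_n, P \in unitmx & similar_diag P (ad_mx a).
Proof.
move=> ah; have [X Xb Xe] := cartan_semisimple h_cartan ah.
have sX : size X = n by rewrite -(size_basis (X := in_tuple X) Xb) dimvf.
have {}Xe (i : 'I_n) : exists c, lie a X`_i = c *: X`_i.
  by apply: Xe; rewrite mem_nth ?sX.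
have [c cE] := fin_all_exists Xe.
pose P := \matrix_(i < n) v2r X`_i.
have Pu : P \in unitmx.
  rewrite -row_full_unit; apply/row_fullP.
  exists (\matrix_(k < n, i < n) coord (in_tuple X) (cast_ord (esym sX) i) 
              (r2v (row k 1%:M))).
  apply/row_matrixP=> k; rewrite row_mul mulmx_sum_row.
  apply: r2v_inj; rewrite linear_sum /=.
  rewrite [RHS](coord_basis (X := in_tuple X) Xb) ?memvf //.
  rewrite (reindex (cast_ord sX)) /=; last first.
    by exists (cast_ord (esym sX)) => i _; rewrite ?cast_ordK ?cast_ordKV.
  by apply: eq_bigr => i _; rewrite linearZ /= rowK v2rK !mxE cast_ordK.
exists P => //; apply/similar_diagPex; exists (\row_i c i).
apply/(similarP Pu); apply/row_matrixP=> i.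
rewrite !row_mul rowK row_ad_mx v2rK cE linearZ /= row_diag_mx mxE.
by rewrite -scalemxAl -rowE rowK.
Qed.

Lemma root_space0 x : root_space lie (0 : wt) x <-> x \in h.
Proof.
split=> [x0 | xh a]; last by rewrite zero_lfunE scale0r (cartan_abelian h_cartan) ?subvsP.
apply: (cartan_self_centralizing h_cartan) => y yh.
by have := x0 (Subvs yh); rewrite zero_lfunE scale0r.
Qed.

Lemma root_spaceD (al : wt) x y :
  root_space lie al x -> root_space lie al y -> root_space lie al (x + y).
Proof. by move=> ax ay a; rewrite linearDr /= ax ay scalerDr. Qed.

Lemma root_spaceZ (al : wt) c x :
  root_space lie al x -> root_space lie al (c *: x).
Proof. by move=> ax a; rewrite linearZr_LR /= ax !scalerA mulrC. Qed.

Lemma root_space_lie (al be : wt) x y : root_space lie al x ->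
  root_space lie be y -> root_space lie (al + be) (lie x y).
Proof.
move=> xal ybe a; rewrite lie_derivation xal ybe linearZl_LR linearZr_LR /=.
by rewrite add_lfunE scalerDl.
Qed.

(** Commuting diagonalizable operators are simultaneously diagonalizable, so
    [g] is the sum of its weight spaces for [h]. *)
Lemma root_space_sum x : exists (al : 'I_n -> wt) (v : 'I_n -> g),
  (forall i, root_space lie (al i) (v i)) /\ x = \sum_i v i.
Proof.
have [P Pu /allP Pd] : exists2 P : 'M_n, P \in unitmx &
    all [pred A | similar_diag P A] [seq ad_mx a | a <- vbasis h].
  apply/codiagonalizableP; split=> [_ _ /mapP[a /vbasis_mem ah ->] /mapP[b /vbasis_mem bh ->]
    | _ /mapP[a /vbasis_mem ah ->]].
    apply/row_matrixP=> i; rewrite !rowE !mulmxA !row_ad_mx !v2rK; congr v2r.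
    by rewrite /= lie_derivation (cartan_abelian h_cartan bh ah) linear0l add0r.
  exact: diagonalizable_ad.
have {}Pd (k : 'I_(\dim h)) : exists d : 'rV_n, P *m ad_mx (vbasis h)`_k = diag_mx d *m P.
  have /Pd /similar_diagPex[d] : ad_mx (vbasis h)`_k \in [seq ad_mx a | a <- vbasis h].
    by rewrite map_f // mem_nth ?size_tuple.
  by move/(similarP Pu); exists d.
have [d dE] := fin_all_exists Pd.
pose al_ i (a : subvs_of h) : K^o := \sum_k coord (vbasis h) k (vsval a) * d k 0 i.
have al_lin i : linear (al_ i).
  move=> c a b; rewrite /al_ scaler_sumr -big_split /=; apply: eq_bigr => k _.
  by rewrite !linearP /= mulrDl -mulrA.
pose alH i := GRing.isLinear.Build _ _ _ _ (al_ i) (al_lin i).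
pose alL i : {linear subvs_of h -> K^o} := HB.pack (al_ i) (alH i).
exists (fun i => linfun (alL i)).
exists (fun i => (v2r x *m invmx P) 0 i *: r2v (row i P)); split=> [i a|]; last first.
  apply: v2r_inj; rewrite -[LHS](mulmxKV Pu) mulmx_sum_row linear_sum /=.
  by apply: eq_bigr => i _; rewrite linearZ /= r2vK.
apply: root_spaceZ => {}a; rewrite lfunE /= /al_.
rewrite {1}(coord_vbasis (subvsP a)) -applyrE linear_sum /=.
rewrite scaler_suml; apply: eq_bigr => k _; rewrite linearZl_LR /= -scalerA; congr (_ *: _).
apply: v2r_inj; rewrite -row_ad_mx -row_mul dE row_mul row_diag_mx.
by rewrite -scalemxAl -rowE !linearZ /= r2vK.
Qed.

End CartanDecomposition.

(** * Enveloping algebras *)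

Section Generation.
Variables (K : fieldType) (g : vectType K) (U : algType K) (iota : {linear g -> U}).

Inductive env_gen : U -> Prop :=
| env_gen_iota x : env_gen (iota x)
| env_gen_scalar c : env_gen c%:A
| env_gen_add u v : env_gen u -> env_gen v -> env_gen (u + v)
| env_gen_mul u v : env_gen u -> env_gen v -> env_gen (u * v).

Definition env_gen_pred : {pred U} := fun u => `[< env_gen u >].

Fact env_gen_closed : subalg_closed env_gen_pred.
Proof.
have Z c u : env_gen u -> env_gen (c *: u).
  by move=> ug; rewrite -[u]mul1r scalerAl; apply: env_gen_mul => //; apply: env_gen_scalar.
split=> [|c u v /asboolP ug /asboolP vg|u v /asboolP ug /asboolP vg]; apply/asboolP.
- by rewrite -(scale1r 1); apply: env_gen_scalar.
- by apply: env_gen_add => //; apply: Z.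
- exact: env_gen_mul.
Qed.

HB.instance Definition _ := GRing.isSubalgClosed.Build K U env_gen_pred env_gen_closed.

Record env_sub := EnvSub { env_val : U; _ : env_val \in env_gen_pred }.
HB.instance Definition _ := [isSub for env_val].
HB.instance Definition _ := [Choice of env_sub by <:].
HB.instance Definition _ := [SubChoice_isSubAlgebra of env_sub by <:].

Definition env_sub_iota (x : g) : env_sub := EnvSub (asboolT (env_gen_iota x)).

Fact env_sub_iota_linear : linear env_sub_iota.
Proof. by move=> c x y; apply: val_inj; rewrite /= linearP. Qed.

HB.instance Definition _ := GRing.isLinear.Build K g env_sub _ env_sub_iota env_sub_iota_linear.

Variable lie : {bilinear g -> g -> g}.
Hypothesis U_env : enveloping_algebra lie iota.

(** The subalgebra generated by [g] has the universal property of [U], so the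
    identity of [U] factors through it. *)
Lemma enveloping_generated u : env_gen u.
Proof.
have [F FE] : exists F : {lrmorphism U -> env_sub}, forall x, F (iota x) = env_sub_iota x.
  apply: (env_ex U_env) => x y; apply: val_inj => /=.
  by rewrite (env_lie U_env).
have env_val_linear : linear (fun u => env_val (F u)).
  by move=> c v w /=; rewrite linearP.
have env_val_monoid : monoid_morphism (fun u => env_val (F u)).
  by split=> [|v w] /=; rewrite ?rmorph1 ?rmorphM.
pose val_F : {lrmorphism U -> U} := HB.pack (fun u => env_val (F u))
  (GRing.isLinear.Build _ _ _ _ (fun u => env_val (F u)) env_val_linear)
  (GRing.isMonoidMorphism.Build _ _ (fun u => env_val (F u)) env_val_monoid).
have <- : env_val (F u) = u.
  have FE' x : val_F (iota x) = iota x by rewrite /= FE.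
  exact: (env_uniq U_env (F := val_F) (G := idfun) FE').
by case: (F u) => v /= /asboolP.
Qed.

End Generation.

Section Casimir.
Variables (K : fieldType) (g : vectType K) (lie : {bilinear g -> g -> g}).
Hypothesis lieP : is_lie_bracket lie.
Variable B : {symmetric g}.
Hypothesis B_inv : forall x y z, B (lie x y) z = B x (lie y z).
Variables (U : algType K) (iota : {linear g -> U}).
Hypothesis iotaP : lie_to_alg lie iota.
Variable L : seq (g * g).
Hypothesis L_dual : forall z,
  z = \sum_(p <- L) B z p.2 *: p.1 /\ z = \sum_(p <- L) B z p.1 *: p.2.

Definition casimir : U := \sum_(p <- L) iota p.1 * iota p.2.

(** Invariance of [B] makes the matrices of [ad x] in the two dual bases
    opposite transposes of each other. *)
Lemma casimir_central x : GRing.comm casimir (iota x).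
Proof.
apply/esym/eqP; rewrite -subr_eq0 /casimir mulr_sumr mulr_suml -sumrB.
have -> : \sum_(p <- L) (iota x * (iota p.1 * iota p.2) - iota p.1 * iota p.2 * iota x) =
    \sum_(p <- L) \sum_(q <- L) B (lie x p.1) q.2 *: (iota q.1 * iota p.2) +
    \sum_(p <- L) \sum_(q <- L) B (lie x p.2) q.1 *: (iota p.1 * iota q.2).
  rewrite -big_split; apply: eq_bigr => p _ /=.
  have -> : \sum_(q <- L) B (lie x p.1) q.2 *: (iota q.1 * iota p.2) =
      iota (lie x p.1) * iota p.2.
    rewrite [in RHS](L_dual (lie x p.1)).1 linear_sum mulr_suml.
    by apply: eq_bigr => q _; rewrite linearZ scalerAl.
  have -> : \sum_(q <- L) B (lie x p.2) q.1 *: (iota p.1 * iota q.2) =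
      iota p.1 * iota (lie x p.2).
    rewrite [in RHS](L_dual (lie x p.2)).2 linear_sum mulr_sumr.
    by apply: eq_bigr => q _; rewrite linearZ scalerAr.
  by rewrite !iotaP mulrBl mulrBr !mulrA addrA subrK.
rewrite [X in X + _]exchange_big /= -big_split big1 // => p _.
rewrite -big_split big1 // => q _ /=.
rewrite -scalerDl (_ : _ + _ = 0) ?scale0r //.
rewrite [B (lie x p.2) _]hermC expr0 mul1r /= (lie_skew lieP x p.2).
by rewrite linearNr /= -B_inv [B _ x]hermC expr0 mul1r /= B_inv subrr.
Qed.

End Casimir.

Section Adjoint.
Variables (K : fieldType) (g : vectType K) (lie : {bilinear g -> g -> g}).
Hypothesis lieP : is_lie_bracket lie.
Variables (U : algType K) (iota : {linear g -> U}).
Hypothesis U_env : enveloping_algebra lie iota.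

Local Notation n := (dim g).

(** The adjoint representation plus a trivial line. Matrices act on row
    vectors from the right, hence the sign. *)
Let ad_block (x : g) : 'M[K]_(1 + n) :=
  block_mx 0 0 0 (- lin1_mx (v2r \o lie x \o r2v)).

Let ad_block_linear : linear ad_block.
Proof.
move=> c x y; rewrite /ad_block scale_block_mx add_block_mx !scaler0 !addr0.
congr (block_mx 0 0 0 _); apply/row_matrixP=> i.
rewrite !rowE mulmxDr -scalemxAr !mulmxN !mul_rV_lin1 /=.
by rewrite linearDl /= linearZl_LR linearP opprD scalerN.
Qed.

Let ad_block_lie x y :
  ad_block (lie x y) = ad_block x *m ad_block y - ad_block y *m ad_block x.
Proof.
rewrite /ad_block !mulmx_block opp_block_mx add_block_mx.
rewrite !(mul0mx, mulmx0, addr0, add0r, oppr0).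
congr (block_mx 0 0 0 _); apply/row_matrixP=> i.
rewrite !rowE mulmxBr !mulNmx !mulmxN !opprK !mulmxA !mul_rV_lin1 /= !v2rK.
rewrite (lie_derivation lieP x y) linearD /=.
by rewrite opprD addrCA subrr addr0.
Qed.

(** In the zero block a scalar has to vanish. *)
Lemma env_scalar_central (x : g) (c : K) :
  iota x = c%:A -> c = 0 /\ forall y, lie x y = 0.
Proof.
pose ad_lin : {linear g -> 'M[K]_(1 + n)} :=
  HB.pack ad_block (GRing.isLinear.Build _ _ _ _ ad_block ad_block_linear).
have [F FE] := env_ex U_env (f := ad_lin) ad_block_lie.
move=> xE; have := FE x; rewrite xE linearZ rmorph1 /= scalemx1.
rewrite -[n.+1]/(1 + n)%N scalar_mx_block /ad_block => /eq_block_mx[c0 _ _ ad0].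
have {}c0 : c = 0 by have /matrixP/(_ 0 0) := c0; rewrite !mxE eqxx.
split=> // y; apply: v2r_inj; rewrite linear0.
have := mul_rV_lin1 (v2r \o lie x \o r2v) (v2r y); rewrite /= v2rK => <-.
by rewrite -[lin1_mx _]opprK -ad0 c0 raddf0 oppr0 mulmx0.
Qed.

End Adjoint.

(** * The field of fractions of U(h) and its shifts *)

Section CartanFractions.
Variables (K : fieldType) (g : vectType K) (h : {vspace g}).
Local Notation wt := ('Hom(subvs_of h, K^o)).
Variables (U : algType K) (iota : {linear g -> U}).
Hypothesis iota_comm : forall a b : subvs_of h,
  GRing.comm (iota (vsval a)) (iota (vsval b)).
Variables (U' : unitAlgType K) (j : {lrmorphism U -> U'}).
Hypothesis U'_loc : ore_localization (in_S h iota) j.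

Local Notation in_Uh := (in_Uh h iota).
Local Notation U'h := (in_U'h h iota j).
Local Notation H a := (j (iota (vsval (a : subvs_of h)))).

Lemma scalarr_comm (A : algType K) (c : K) (x : A) : GRing.comm c%:A x.
Proof. by rewrite /GRing.comm mulr_algl mulr_algr. Qed.

Lemma env_map_scalar c : j c%:A = c%:A.
Proof. by rewrite linearZ rmorph1. Qed.

Lemma Uh_comm u v : in_Uh u -> in_Uh v -> GRing.comm u v.
Proof.
have genC (a : subvs_of h) w : in_Uh w -> GRing.comm (iota (vsval a)) w.
  elim=> {w} [b|c|u1 v1 _ + _|u1 v1 _ + _]; first exact: iota_comm.
  - exact/commr_sym/scalarr_comm.
  - exact: commrD.
  - exact: commrM.
move=> uh vh; apply: commr_sym; elim: uh => {u} [a|c|u1 v1 _ + _|u1 v1 _ + _].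
- exact/commr_sym/genC.
- exact/commr_sym/scalarr_comm.
- exact: commrD.
- exact: commrM.
Qed.

Lemma Uh1 : in_Uh 1.
Proof. by rewrite -(scale1r 1); apply: Uh_scalar. Qed.

Lemma S1 : in_S h iota 1.
Proof. by split; [exact: Uh1 | apply/eqP/oner_neq0]. Qed.

(** Elements of [S] are units in the localization, so [U(h)] has no zero
    divisors. *)
Lemma SM s t : in_S h iota s -> in_S h iota t -> in_S h iota (s * t).
Proof.
move=> sS tS; split; first by apply: Uh_mul; [case: sS | case: tS].
move=> st0; have : j (s * t) \is a GRing.unit by rewrite rmorphM unitrMl ?(loc_unit U'_loc).
by rewrite st0 rmorph0 unitr0.
Qed.

Lemma U'h_j u : in_Uh u -> U'h (j u).
Proof. by exists 1, u; split; rewrite ?rmorph1 ?invr1 ?mul1r //; exact: S1. Qed.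

Lemma U'h_gen a : U'h (H a).
Proof. exact/U'h_j/Uh_gen. Qed.

Lemma U'h_scalar c : U'h c%:A.
Proof. by have := U'h_j (Uh_scalar h iota c); rewrite linearZ rmorph1. Qed.

Lemma U'h_comm x y : U'h x -> U'h y -> GRing.comm x y.
Proof.
have jC u v : in_Uh u -> in_Uh v -> GRing.comm (j u) (j v).
  by move=> uh vh; rewrite /GRing.comm -!rmorphM Uh_comm.
move=> [s [u [[sh _] uh ->]]] [t [v [[th _] vh ->]]].
have C w : in_Uh w -> GRing.comm (j w) ((j t)^-1 * j v).
  by move=> wh; apply: commrM; [apply: commrV|]; apply: jC.
by apply/commr_sym/commrM; [apply: commrV|]; apply/commr_sym/C.
Qed.

Lemma U'hM x y : U'h x -> U'h y -> U'h (x * y).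
Proof.
move=> xh [t [v [tS vh yE]]]; have [s [u [sS uh xE]]] := xh.
exists (t * s), (u * v); split; [exact: SM | exact: Uh_mul |].
rewrite !rmorphM invrM ?(loc_unit U'_loc) // yE xE -!mulrA; congr (_ * _).
rewrite !mulrA; congr (_ * _); apply: commrV.
by rewrite /GRing.comm -!rmorphM Uh_comm //; case: tS.
Qed.

Lemma U'hD x y : U'h x -> U'h y -> U'h (x + y).
Proof.
move=> [s [u [sS uh ->]]] [t [v [tS vh ->]]].
have js := loc_unit U'_loc sS; have jt := loc_unit U'_loc tS.
exists (t * s), (t * u + s * v); split; first exact: SM.
  by apply: Uh_add; apply: Uh_mul => //; [case: tS | case: sS].
rewrite rmorphD !rmorphM invrM // mulrDr -!mulrA mulKr //; congr (_ + _).
have tsC : (j t)^-1 * j s = j s * (j t)^-1.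
  by apply/commr_sym/commrV; rewrite /GRing.comm -!rmorphM Uh_comm //; [case: sS | case: tS].
by rewrite (mulrA (j t)^-1) tsC -mulrA mulKr.
Qed.

Lemma U'hZ c x : U'h x -> U'h (c *: x).
Proof. by move=> xh; rewrite -mulr_algl; apply: U'hM => //; apply: U'h_scalar. Qed.

Lemma U'hN x : U'h x -> U'h (- x).
Proof. by move=> xh; rewrite -scaleN1r; apply: U'hZ. Qed.

Lemma U'h0 : U'h 0.
Proof. by rewrite -(scale0r 1); apply: U'h_scalar. Qed.

Lemma U'h1 : U'h 1.
Proof. by rewrite -(scale1r 1); apply: U'h_scalar. Qed.

Lemma U'hV x : U'h x -> U'h x^-1.
Proof.
move=> xh; have [xu|/invr_out->//] := boolP (x \is a GRing.unit).
have [s [u [sS uh xE]]] := xh; have js := loc_unit U'_loc sS.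
have ju : j u \is a GRing.unit by rewrite -[j u](mulVKr js) -xE unitrMl.
exists u, s; split; last by rewrite xE invrM ?unitrV // invrK.
- by split=> // u0; move: ju; rewrite u0 rmorph0 unitr0.
- by case: sS.
Qed.

Section Shift.
Variables (la : wt) (sigma : U' -> U').
Hypothesis sigmaP : is_shift iota j la sigma.

Lemma shift0 : sigma 0 = 0.
Proof. by rewrite -(scale0r 1) (shift_scale sigmaP) ?scale0r //; exact: U'h1. Qed.

Lemma shiftN x : U'h x -> sigma (- x) = - sigma x.
Proof. by move=> xh; rewrite -!scaleN1r (shift_scale sigmaP). Qed.

Lemma shiftB x y : U'h x -> U'h y -> sigma (x - y) = sigma x - sigma y.
Proof. by move=> xh yh; rewrite (shift_add sigmaP) ?shiftN //; exact: U'hN. Qed.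

Lemma shift_scalar c : sigma c%:A = c%:A.
Proof. by rewrite (shift_scale sigmaP) ?(shift_one sigmaP) //; exact: U'h1. Qed.

Lemma shift_nat n : sigma n%:R = n%:R.
Proof. by rewrite -scaler_nat shift_scalar. Qed.

Lemma shift_unit x : U'h x -> x \is a GRing.unit ->
  sigma x \is a GRing.unit /\ sigma x^-1 = (sigma x)^-1.
Proof.
move=> xh xu; have xVh := U'hV xh.
have l : sigma x^-1 * sigma x = 1 by rewrite -(shift_mul sigmaP) // mulVr // (shift_one sigmaP).
have r : sigma x * sigma x^-1 = 1 by rewrite -(shift_mul sigmaP) // divrr // (shift_one sigmaP).
have su : sigma x \is a GRing.unit by apply/unitrP; exists (sigma x^-1).
by split=> //; rewrite -[LHS]mulr1 -(divrr su) mulrA l mul1r.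
Qed.

(** Both sides are additive and multiplicative in [x], so the generators of
    [U(h)] decide. *)
Lemma shift_intertwine X : (forall a, X * H a = (H a + (la a : K)%:A) * X) ->
  forall x, U'h x -> X * x = sigma x * X.
Proof.
move=> XH; have Xj u : in_Uh u -> X * j u = sigma (j u) * X.
  elim=> {u} [a|c|u v uh IHu vh IHv|u v uh IHu vh IHv].
  - by rewrite XH (shift_gen sigmaP).
  - by rewrite linearZ rmorph1 shift_scalar (scalarr_comm c X).
  - rewrite rmorphD mulrDr IHu IHv (shift_add sigmaP) ?mulrDl //; exact: U'h_j.
  - rewrite rmorphM mulrA IHu -mulrA IHv mulrA (shift_mul sigmaP) //; exact: U'h_j.
move=> x [s [u [sS uh xE]]]; have js := loc_unit U'_loc sS.
have sh : U'h (j s) by case: sS => sh _; apply: U'h_j.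
have [ssu sVE] := shift_unit sh js.
rewrite xE (shift_mul sigmaP) ?sVE; [|exact: U'hV|exact: U'h_j].
rewrite -mulrA -Xj // !mulrA; congr (_ * _).
apply: (mulrI ssu); rewrite [RHS]mulrA divrr // mul1r mulrA -Xj; last by case: sS.
by rewrite mulrK.
Qed.

End Shift.

Lemma shift_ext (la : wt) s1 s2 : is_shift iota j la s1 -> is_shift iota j la s2 ->
  forall x, U'h x -> s1 x = s2 x.
Proof.
move=> s1P s2P; have E u : in_Uh u -> s1 (j u) = s2 (j u).
  elim=> {u} [a|c|u v uh IHu vh IHv|u v uh IHu vh IHv].
  - by rewrite (shift_gen s1P) (shift_gen s2P).
  - by rewrite linearZ rmorph1 (shift_scalar s1P) (shift_scalar s2P).
  - by rewrite rmorphD (shift_add s1P) ?(shift_add s2P) ?IHu ?IHv //; exact: U'h_j.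
  - by rewrite rmorphM (shift_mul s1P) ?(shift_mul s2P) ?IHu ?IHv //; exact: U'h_j.
move=> x [s [u [sS uh ->]]]; have js := loc_unit U'_loc sS.
have sh : U'h (j s) by case: sS => sh _; apply: U'h_j.
rewrite (shift_mul s1P) ?(shift_mul s2P) ?(shift_unit s1P sh js).2 ?(shift_unit s2P sh js).2 ?E //;
  by [case: sS | exact: U'hV | exact: U'h_j].
Qed.

Lemma shift_id : is_shift iota j (0 : wt) id.
Proof.
split=> // y; first by exists y.
by rewrite zero_lfunE scale0r addr0.
Qed.

Lemma shift_comp (la mu : wt) s1 s2 : is_shift iota j la s1 -> is_shift iota j mu s2 ->
  is_shift iota j (la + mu) (s1 \o s2).
Proof.
move=> s1P s2P; have st := shift_stable s2P; split=> /=.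
- by move=> x /st/(shift_stable s1P).
- by move=> x y xh yh /(shift_inj s1P (st _ xh) (st _ yh))/(shift_inj s2P xh yh).
- move=> y /(shift_surj s1P)[x /(shift_surj s2P)[z zh <-] <-].
  by exists z.
- by rewrite (shift_one s2P) (shift_one s1P).
- by move=> x y xh yh; rewrite (shift_add s2P) // (shift_add s1P) //; exact: st.
- by move=> x y xh yh; rewrite (shift_mul s2P) // (shift_mul s1P) //; exact: st.
- by move=> c x xh; rewrite (shift_scale s2P) // (shift_scale s1P) //; exact: st.
- move=> a; rewrite (shift_gen s2P) (shift_add s1P); [|exact: U'h_gen|exact: U'h_scalar].
  by rewrite (shift_gen s1P) (shift_scalar s1P) -addrA -scalerDl add_lfunE.
Qed.

End CartanFractions.

(** * Root strings *)

Section ExtremalProjector.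
Variables (K : numFieldType) (g : vectType K) (lie : {bilinear g -> g -> g}).
Hypotheses (lieP : is_lie_bracket lie) (g_reductive : reductive lie).
Variable B : {symmetric g}.
Hypothesis BP : invariant_nondegenerate lie B.
Variable h : {vspace g}.
Hypothesis h_cartan : cartan_subalgebra lie h.
Local Notation wt := ('Hom(subvs_of h, K^o)).
Variable Dp : {fset wt}.
Hypothesis DpP : positive_system lie Dp.
Variables e f : wt -> g.
Hypothesis efP : root_vectors lie B Dp e f.
Variable hv : wt -> subvs_of h.
Hypothesis hvP : is_coroot_map B hv.

Local Notation ip := (weight_form B hv).
Local Notation is_root := (@is_root _ _ lie h).
Local Notation root_space := (@root_space _ _ lie h).

Lemma form_sym x y : B x y = B y x.
Proof. by rewrite hermC expr0 mul1r. Qed.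

Lemma root_space_orth (al be : wt) x y : root_space al x ->
  root_space be y -> al + be <> 0 -> B x y = 0.
Proof.
move=> xal ybe ab0; apply/eqP/negPn/negP => Bxy; apply: ab0; apply/lfunP => a.
rewrite zero_lfunE add_lfunE.
have := form_invariant BP x (vsval a) y.
rewrite (lie_skew lieP x) xal ybe linearNl /= linearZl_LR linearZr_LR /=.
move/eqP; rewrite -subr_eq0 -opprD -mulrDl oppr_eq0 mulf_eq0 (negPf Bxy) orbF.
by move/eqP.
Qed.

Lemma weight_sep (a : subvs_of h) : (forall la : wt, la a = 0) -> a = 0.
Proof.
move=> a0; rewrite (coord_vbasis (memvf a)); apply: big1 => i _.
suff -> : coord (vbasis fullv) i a = 0 by rewrite scale0r.
by have := a0 (linfun (coord (vbasis fullv) i : _ -> K^o)); rewrite lfunE.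
Qed.

(** Every weight [la] is the pairing with [hv la], and weights separate points. *)
Lemma form_cartan_inj (a b : subvs_of h) :
  (forall c : subvs_of h, B (vsval a) (vsval c) = B (vsval b) (vsval c)) ->
  a = b.
Proof.
move=> ab; apply/eqP; rewrite -subr_eq0; apply/eqP/weight_sep => la.
rewrite -[LHS]hvP linearBr /= form_sym (form_sym _ (vsval b)).
by apply/eqP; rewrite subr_eq0; apply/eqP/ab.
Qed.

Lemma hvD la mu : hv (la + mu) = hv la + hv mu.
Proof.
apply: form_cartan_inj => c; rewrite linearDl /= !hvP.
by rewrite add_lfunE.
Qed.

Lemma hv0 : hv 0 = 0.
Proof. by apply: (addrI (hv 0)); rewrite -hvD !addr0. Qed.

Lemma hvN la : hv (- la) = - hv la.
Proof. by apply: (addrI (hv la)); rewrite -hvD !subrr hv0. Qed.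

Lemma ip_eval la mu : ip la mu = la (hv mu).
Proof. exact: hvP. Qed.

Lemma ip_sym la mu : ip la mu = ip mu la.
Proof. exact: form_sym. Qed.

Lemma ipDl la mu nu : ip (la + mu) nu = ip la nu + ip mu nu.
Proof. by rewrite /weight_form hvD linearDl. Qed.

Lemma ipDr la mu nu : ip nu (la + mu) = ip nu la + ip nu mu.
Proof. by rewrite !(ip_sym nu) ipDl. Qed.

Lemma ipNl la nu : ip (- la) nu = - ip la nu.
Proof. by rewrite /weight_form hvN linearNl. Qed.

Lemma ipNr la nu : ip nu (- la) = - ip nu la.
Proof. by rewrite !(ip_sym nu) ipNl. Qed.

Lemma ip0l nu : ip 0 nu = 0.
Proof. by rewrite /weight_form hv0 linear0l. Qed.

Lemma ipMnl la nu n : ip (la *+ n) nu = n%:R * ip la nu.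
Proof. by elim: n => [|n IH]; rewrite ?ip0l ?mul0r // mulrS ipDl IH mulrSr mulrDl mul1r addrC. Qed.

(** The difference of the two sides lies in [h] and is orthogonal to it. *)
Lemma lie_opposite (al : wt) x y : root_space al x ->
  root_space (- al) y -> lie x y = B x y *: vsval (hv al).
Proof.
move=> xal yal.
have xyh : lie x y \in h.
  by rewrite -(root_space0 h_cartan) -(subrr al); apply: root_space_lie.
rewrite -[LHS]/(vsval (Subvs xyh)) -[RHS]linearZ; congr vsval.
apply: form_cartan_inj => c; rewrite [in RHS]linearZ /=.
rewrite linearZl_LR /= hvP (form_invariant BP) (lie_skew lieP) yal.
by rewrite linearNr linearZr_LR /= opp_lfunE mulNr opprK mulrC.
Qed.

Lemma root_opp al : is_root al -> is_root (- al).
Proof.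
by move/(pos_cover DpP)=> aD; apply/(pos_cover DpP); rewrite opprK; case: aD; [right|left].
Qed.

Lemma root_pos al : al \in Dp -> is_root al.
Proof. by move=> aD; apply/(pos_cover DpP); left. Qed.

Lemma root_neq0 al : is_root al -> al <> 0.
Proof. by case. Qed.

(** The weights [be + k al] are pairwise distinct, while there are only finitely
    many roots. *)
Lemma root_string_finite al be : al <> 0 ->
  exists k, forall v, root_space (be + al *+ k) v -> v = 0.
Proof.
move=> al0; apply: contrapT => /forallNP nfin.
have {}nfin k : be + al *+ k \in 0 :: (Dp : seq wt) ++ [seq - x | x <- Dp].
  have /existsNP[v /not_implyP[vk v0]] := nfin k.
  rewrite inE; case: eqP => //= kn0; rewrite mem_cat.
  have /(pos_cover DpP)[->//|kD] : is_root (be + al *+ k) by split=> //; exists v.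
  by rewrite -[be + _]opprK map_f ?orbT.
set s := _ :: _ in nfin.
have := @uniq_leq_size _ [seq be + al *+ k | k <- iota 0 (size s).+1] s.
rewrite size_map size_iota ltnn => H; suff: false by [].
apply: H => [|_ /mapP[k _ ->]]; last exact: nfin.
rewrite map_inj_uniq ?iota_uniq // => k l /addrI/eqP.
wlog kl : k l / (k <= l)%N.
  by case/orP: (leq_total k l) => kl H; [apply: H | rewrite eq_sym => /H->].
rewrite eq_sym -subr_eq0 -mulrnBr // -scaler_nat scaler_eq0 pnatr_eq0 subn_eq0.
by case/orP=> [lk|/eqP//]; apply/eqP; rewrite eqn_leq kl.
Qed.

Section Chain.
Variables (al be : wt) (x y v : g).
Hypotheses (x_al : root_space al x) (y_al : root_space (- al) y).
Hypotheses (xy1 : B x y = 1) (al0 : al <> 0).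
Hypotheses (v_be : root_space be v) (v0 : v <> 0) (xv0 : lie x v = 0).

Lemma chain_weight k : root_space (be - al *+ k) (iter k (lie y) v).
Proof.
elim: k => [|k IH] /=; first by rewrite mulr0n subr0.
by rewrite mulrS opprD addrCA; apply: root_space_lie.
Qed.

Lemma chain_raise k : lie x (iter k.+1 (lie y) v) =
  (k.+1%:R * (ip be al - k%:R * ip al al / 2)) *: iter k (lie y) v.
Proof.
have xyE : lie x y = vsval (hv al) by rewrite (lie_opposite x_al y_al) xy1 scale1r.
elim: k => [|k IH].
  by rewrite /= lie_derivation // xyE xv0 linear0r addr0 v_be -ip_eval !mul0r subr0 mul1r.
rewrite iterS lie_derivation // IH xyE chain_weight linearZr_LR /= -scalerDl.
congr (_ *: _); rewrite -ip_eval ipDl ipNl ipMnl.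
by rewrite !mulrS; field.
Qed.

(** The first [k] for which [y^k v] vanishes determines the weight of [v], by
    [chain_raise]. No division by [ip al al] is made, so that the conclusion is
    also informative when that number is 0. *)
Lemma chain_top : exists n, ip be al = n%:R * ip al al / 2 /\
  forall k, (k <= n)%N -> iter k (lie y) v <> 0.
Proof.
have ex0 : exists k, iter k (lie y) v == 0.
  have [|k kP] := @root_string_finite (- al) be.
    by move/eqP; rewrite oppr_eq0 => /eqP.
  by exists k; apply/eqP/kP; rewrite mulNrn; exact: chain_weight.
case: (ex_minnP ex0) => -[/eqP//|n /eqP n0 nmin].
exists n; split=> [|k kn /eqP /nmin]; last by rewrite ltnNge kn.
have := chain_raise n; rewrite n0 linear0r => /esym/eqP; rewrite scaler_eq0.
case/orP => [|/nmin]; last by rewrite ltnn.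
by rewrite mulf_eq0 pnatr_eq0 subr_eq0 => /eqP.
Qed.

End Chain.

Lemma root_pair al : is_root al -> exists x y,
  [/\ root_space al x, root_space (- al) y & B x y = 1].
Proof.
case/(pos_cover DpP)=> aD.
  exists (e al), (f al); split; last exact: (ef_pairing efP).
    by case: (e_root efP aD).
  exact: (f_root efP).
exists (f (- al)), (e (- al)); split; last by rewrite form_sym (ef_pairing efP).
  by have := f_root efP aD; rewrite opprK.
by case: (e_root efP aD).
Qed.

(** Here [p] is the distance from [be] to the top of its [al]-string, and [m] is
    the number of steps down from that top. *)
Lemma string_weight al be (v : g) : is_root al ->
  root_space be v -> v <> 0 -> exists p m : nat,
  [/\ ip be al = (m%:R - (p *+ 2)%:R) * ip al al / 2,
      (be + al <> 0 /\ ~ is_root (be + al)) -> p = 0%N &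
      forall k, (k <= m)%N ->
        exists2 w, root_space (be + al *+ p - al *+ k) w & w <> 0].
Proof.
move=> al_root vbe v0; have [x [y [xal yal xy1]]] := root_pair al_root.
have al0 := root_neq0 al_root.
have raise k : root_space (be + al *+ k) (iter k (lie x) v).
  elim: k => [|k IH]; first by rewrite addr0.
  by rewrite mulrS addrCA; apply: root_space_lie.
have ex0 : exists k, iter k (lie x) v == 0.
  by have [k kP] := root_string_finite be al0; exists k; apply/eqP/kP.
case: (ex_minnP ex0) => -[/eqP//|p /eqP p0 pmin].
have wp0 : iter p (lie x) v <> 0 by move/eqP/pmin; rewrite ltnn.
have [m [mE mP]] := chain_top xal yal xy1 al0 (raise p) wp0 p0.
exists p, m; split=> [|[n0 nr]|k km].
- move: mE; rewrite ipDl ipMnl => /(canRL (addrK _)) ->.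
  by rewrite mulr2n natrD; field.
- case: p pmin {p0 mE mP} wp0 (raise p) => // p pmin wp0 _; case: nr; split=> //.
  exists (lie x v); first by have := raise 1%N; rewrite mulr1n.
  by move=> xv0; have := pmin 1%N; rewrite /= xv0 eqxx => /(_ isT).
- exists (iter k (lie y) (iter p (lie x) v)); last exact: mP.
  exact: chain_weight.
Qed.

(** * Roots and their pairings *)

(** A complementary ideal of the line spanned by [z] contains all brackets. *)
Lemma central_bracket_eq0 z x y :
  (forall u, lie z u = 0) -> z = lie x y -> z = 0.
Proof.
move=> zc zE; have zI : lie_ideal lie <[z]>%VS.
  move=> u _ /vlineP[c ->].
  by rewrite linearZr_LR /= (lie_skew lieP) zc oppr0 scaler0 mem0v.
have [J [JI IJ I0]] := g_reductive zI.
suff : z \in (<[z]> :&: J)%VS by rewrite I0 memv0 => /eqP.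
rewrite memv_cap memv_line /= zE.
have : x \in (<[z]> + J)%VS by rewrite IJ memvf.
case/memv_addP=> _ /vlineP[c ->] [x' x'J ->].
rewrite linearDl /= linearZl_LR /= zc scaler0 add0r (lie_skew lieP) memvN.
exact: JI.
Qed.

(** If [al] were isotropic, [string_weight] would make all weights vanish on
    [h_al], so [h_al = [e, f]] would be central. *)
Lemma ip_root_neq0 al : is_root al -> ip al al != 0.
Proof.
move=> al_root; apply/eqP => al_iso.
have [x [y [xal yal xy1]]] := root_pair al_root.
have hE : vsval (hv al) = lie x y.
  by rewrite (lie_opposite xal yal) xy1 scale1r.
suff hc u : lie (vsval (hv al)) u = 0.
  have h0 := central_bracket_eq0 hc hE.
  case: (root_neq0 al_root); apply/lfunP => a.
  by rewrite zero_lfunE -hvP h0 linear0l.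
have [be [v [vbe ->]]] := root_space_sum lieP h_cartan u.
rewrite linear_sumr big1 // => i _; rewrite (vbe i).
have [->|/eqP v0] := eqVneq (v i) 0; first by rewrite scaler0.
have [p [m [ipE _ _]]] := string_weight al_root (vbe i) v0.
by rewrite -ip_eval ipE al_iso mulr0 mul0r scale0r.
Qed.

(** Otherwise some vector [w] of weight [al] is killed by [y] and is thus the
    lowest vector of a string, although [al] takes the positive value 2 on its
    coroot. *)
Lemma root_space_line al x y v : is_root al -> root_space al x ->
  root_space (- al) y -> B x y = 1 -> root_space al v -> v = B v y *: x.
Proof.
move=> al_root xal yal xy1 val; pose w := v + (- B v y) *: x.
have wal : root_space al w by apply: root_spaceD => //; apply: root_spaceZ.
suff /eqP : w = 0 by rewrite /w scaleNr subr_eq0 => /eqP.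
apply: contrapT => w0.
have yw0 : lie y w = 0.
  rewrite (lie_skew lieP) (lie_opposite wal yal).
  by rewrite linearDl /= linearZl_LR /= xy1 mulr1 subrr scale0r oppr0.
have x'al : root_space (- - al) x by rewrite opprK.
have nal0 : - al <> 0 by move/eqP; rewrite oppr_eq0 => /eqP/(root_neq0 al_root).
have yx1 : B y x = 1 by rewrite form_sym.
have [n []] := chain_top yal x'al yx1 nal0 wal w0 yw0.
rewrite !ipNr // ipNl // opprK => ipE _.
have : ip al al * (1 + n%:R / 2) = 0.
  by rewrite mulrDr mulr1 mulrA [_ * n%:R]mulrC -ipE subrr.
move/eqP; rewrite mulf_eq0 (negPf (ip_root_neq0 al_root)) /=.
by rewrite gt_eqF // ltr_wpDr // divr_ge0.
Qed.

(** The value of [la] on the coroot of [al]. *)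
Definition pairing (la al : wt) : K := 2 * ip la al / ip al al.

Lemma pairingDl la mu al : pairing (la + mu) al = pairing la al + pairing mu al.
Proof. by rewrite /pairing ipDl // mulrDr mulrDl. Qed.

Lemma pairingNl la al : pairing (- la) al = - pairing la al.
Proof. by rewrite /pairing ipNl // mulrN mulNr. Qed.

Lemma pairing0 al : pairing 0 al = 0.
Proof. by rewrite /pairing ip0l // mulr0 mul0r. Qed.

Lemma pairing_sum s al : pairing (\sum_(b <- s) b) al = \sum_(b <- s) pairing b al.
Proof. exact: (big_morph (pairing^~ al) (fun x y => pairingDl x y al) (pairing0 al)). Qed.

Lemma pairingNr la al : pairing la (- al) = - pairing la al.
Proof. by rewrite /pairing !ipNr // ipNl // opprK mulrN mulNr. Qed.

Lemma pairing_self al : is_root al -> pairing al al = 2.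
Proof. by move/ip_root_neq0=> a0; rewrite /pairing mulfK. Qed.

Lemma pairing_string be al : is_root be -> is_root al -> exists p m : nat,
  [/\ pairing be al = m%:R - (p *+ 2)%:R,
      (be + al <> 0 /\ ~ is_root (be + al)) -> p = 0%N &
      forall k, (k <= m)%N -> be + al *+ p - al *+ k <> 0 ->
        is_root (be + al *+ p - al *+ k)].
Proof.
move=> [_ [v vbe v0]] al_root; have a0 := ip_root_neq0 al_root.
have [p [m [ipE p0 mP]]] := string_weight al_root vbe v0.
exists p, m; split=> //; last by move=> k /mP[w ww w0] ?; split=> //; exists w.
by rewrite /pairing ipE; field.
Qed.

Lemma pairing_real be al : is_root be -> is_root al -> pairing be al \is Num.real.
Proof.
by move=> rb ra; have [p [m [-> _ _]]] := pairing_string rb ra; rewrite rpredB ?realn.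
Qed.

(** If [be + al] is not a root, [be] is the top of its string, where the pairing
    is nonnegative. *)
Lemma pairing_lt0 be al : is_root be -> is_root al -> pairing be al < 0 ->
  be + al <> 0 -> is_root (be + al).
Proof.
move=> rb ra + n0; have [p [m [-> p0 _]]] := pairing_string rb ra.
by apply: contraPP => nr; rewrite p0 // mul0rn subr0 ltrn0.
Qed.

Lemma pairing_gt0 be al : is_root be -> is_root al -> 0 < pairing be al ->
  be - al <> 0 -> is_root (be - al).
Proof.
move=> rb ra lt0; apply: pairing_lt0 => //; first exact: root_opp.
by rewrite pairingNr oppr_lt0.
Qed.

Definition refl (al be : wt) : wt := be - pairing be al *: al.

Lemma pairing_refl al be : is_root al -> pairing (refl al be) al = - pairing be al.
Proof.
move=> ra; rewrite /refl; set c := pairing be al.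
rewrite pairingDl pairingNl.
have -> : pairing (c *: al) al = c * 2.
  by rewrite -(pairing_self ra) /pairing !ip_eval scale_lfunE -[_ *: _]/(c * _) mulrCA !mulrA.
by rewrite -/c; ring.
Qed.

Lemma reflK al : is_root al -> involutive (refl al).
Proof.
move=> ra be; rewrite {1}/refl pairing_refl // /refl scaleNr opprK.
exact: subrK.
Qed.

(** With [p] and [m] as in [string_weight] and a nonnegative pairing, the
    reflected weight lies [m - p] steps below the top of the string. *)
Lemma refl_root al be : is_root al -> is_root be -> is_root (refl al be).
Proof.
move=> ra rb.
have r0 : refl al be <> 0.
  move=> s0; case: (root_neq0 rb); rewrite -(reflK ra be) s0 /refl.
  by rewrite pairing0 scale0r subr0.
wlog : al ra r0 / 0 <= pairing be al => [wl|ge0].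
  have /orP[|le0] := real_leVge (real0 K) (pairing_real rb ra); first exact: wl.
  have rE : refl (- al) be = refl al be by rewrite /refl pairingNr scaleNr scalerN opprK.
  rewrite -rE; apply: wl; rewrite ?rE //; first exact: root_opp.
  by rewrite pairingNr oppr_ge0.
have [p [m [cE _ mP]]] := pairing_string rb ra.
have pm : (p *+ 2 <= m)%N by rewrite -(ler_nat K) -subr_ge0 -cE.
have rE : refl al be = be + al *+ p - al *+ (m - p)%N.
  rewrite /refl cE -natrB // scaler_nat -[in RHS]addrA; congr (_ + _).
  apply/eqP; rewrite eqr_oppLR opprB; apply/eqP.
  by rewrite -mulrnBr; [congr (_ *+ _)|]; move: pm; rewrite mulr2n; lia.
by rewrite rE in r0 *; apply: mP => //; rewrite leq_subr.
Qed.

Lemma ip_refl al la mu : is_root al ->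
  ip la (refl al mu) = ip la mu - pairing mu al * ip la al.
Proof.
by move=> ra; rewrite ![ip la _](ip_sym) !ip_eval /refl add_lfunE opp_lfunE scale_lfunE.
Qed.

Lemma pairing_reflr al la be : is_root al -> is_root be ->
  pairing la (refl al be) = pairing la be - pairing la al * pairing al be.
Proof.
move=> ra rb; have a0 := ip_root_neq0 ra; have b0 := ip_root_neq0 rb.
have -> : pairing la (refl al be) = 2 * (ip la be - pairing be al * ip la al) / ip be be.
  rewrite {1}/pairing ip_refl //; congr (_ / _).
  rewrite ip_refl // !(ip_sym (refl _ _)) !ip_refl // (ip_sym al be) /pairing.
  by field.
by rewrite /pairing (ip_sym be al); field; rewrite a0 b0.
Qed.

Definition roots : seq wt := (Dp : seq wt) ++ [seq - al | al <- Dp].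

Lemma mem_roots al : al \in roots <-> is_root al.
Proof.
rewrite mem_cat; split=> [/orP[aD|/mapP[be bD ->]]|/(pos_cover DpP)[->//|aD]].
- exact: root_pos.
- exact/root_opp/root_pos.
- by rewrite -[al]opprK map_f ?orbT.
Qed.

Lemma perm_refl_roots al : is_root al -> perm_eq [seq refl al be | be <- roots] roots.
Proof.
move=> ra; have Ru : uniq roots.
  rewrite cat_uniq fset_uniq map_inj_uniq ?fset_uniq ?andbT //; last exact: oppr_inj.
  apply/hasPn => _ /mapP[be bD ->]; exact: (pos_disjoint DpP).
have Ru' : uniq [seq refl al be | be <- roots] by rewrite (map_inj_uniq (inv_inj (reflK ra))).
apply: uniq_perm => //; apply: (uniq_min_size Ru' _ _).2; last by rewrite size_map.
by move=> _ /mapP[be /mem_roots rb ->]; apply/mem_roots/refl_root.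
Qed.

(** A form that is invariant under the reflections and, unlike [ip], real and
    nonnegative on integral combinations of the roots. *)
Definition qform (la mu : wt) : K := \sum_(be <- roots) pairing la be * pairing mu be.

(** Reindexing the sum by the reflection in [al] changes [qform la al] into
    [pairing la al * qform al al - qform la al]. *)
Lemma qform_root la al : is_root al -> 2 * qform la al = pairing la al * qform al al.
Proof.
move=> ra; rewrite mulr2n mulrDl mul1r {1}/qform.
rewrite -(perm_big _ (perm_refl_roots ra)) big_map /= -big_split /= mulr_sumr.
apply: eq_big_seq => be /mem_roots rb.
rewrite !pairing_reflr // (pairing_self ra); ring.
Qed.

Lemma qform_gt0 al : is_root al -> 0 < qform al al.
Proof.
move=> ra; have /mem_roots aR := ra.
rewrite /qform (big_rem _ aR) /= (pairing_self ra) ltr_wpDr // ?mulr_gt0 //.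
rewrite big_seq sumr_ge0 // => be /mem_rem/mem_roots rb.
by rewrite -expr2 real_exprn_even_ge0 // pairing_real.
Qed.

(** * Sums of positive roots *)

Local Notation simple_root := (@simple_root K g h Dp).
Local Notation wsum s := (\sum_(b <- s) b).

Lemma sum_lt0_ex (I : eqType) (s : seq I) (F : I -> K) :
  (forall i, i \in s -> F i \is Num.real) -> \sum_(i <- s) F i < 0 ->
  exists2 i, i \in s & F i < 0.
Proof.
move=> Fr; apply: contraPP => nF; apply/negP; rewrite -real_leNgt ?real0 //.
  rewrite big_seq sumr_ge0 // => i si; rewrite real_leNgt ?real0 ?Fr //.
  by apply/negP => Fi; apply: nF; exists i.
by rewrite big_seq rpred_sum.
Qed.

(** If no root of [s] pairs positively with the sum, two roots of [s] pair
    negatively and can be merged into a single positive root. *)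
Lemma pos_sum_pairing (s : seq wt) : s != [::] -> {subset s <= Dp} ->
  exists2 ga, ga \in Dp & 0 < pairing (wsum s) ga.
Proof.
elim: {s}_.+1 {-2}s (ltnSn (size s)) => // n IH [|b t] //= tn _ sD.
have bD : b \in Dp by apply: sD; rewrite mem_head.
have tD c : c \in t -> c \in Dp by move=> ct; apply: sD; rewrite inE ct orbT.
have rb := root_pos bD.
have rt c : c \in t -> pairing c b \is Num.real.
  by move=> ct; apply: pairing_real => //; apply/root_pos/tD.
have rs : \sum_(c <- t) pairing c b \is Num.real.
  by rewrite big_seq rpred_sum.
rewrite big_cons.
have [pos|le0] := real_ltP (real0 K) (rpredD (realn _ 2) rs).
  by exists b => //; rewrite pairingDl pairing_self // pairing_sum.
have [|c ct cb] := sum_lt0_ex rt.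
  by rewrite (le_lt_trans (y := -2)) // ?oppr_lt0 // -subr_le0 opprK addrC.
have cb0 : c + b <> 0.
  move/eqP; rewrite addr_eq0 => /eqP cE.
  by have := pos_disjoint DpP bD; rewrite -cE tD.
have cbD : c + b \in Dp.
  by apply: (pos_add DpP (tD _ ct) bD); apply: pairing_lt0 => //; apply/root_pos/tD.
have [||ga gaD ga_pos] := IH ((c + b) :: rem c t) _ isT.
- by rewrite /= size_rem //; case: (t) ct tn.
- by move=> d; rewrite inE => /orP[/eqP->//|/mem_rem/tD].
exists ga => //; move: ga_pos; rewrite big_cons [X in _ -> _ < pairing (_ + X) _](big_rem _ ct) /=.
by rewrite addrCA addrA.
Qed.

Lemma pos_sum_neq0 (s : seq wt) : s != [::] -> {subset s <= Dp} -> wsum s <> 0.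
Proof. by move=> s0 /(pos_sum_pairing s0)[ga _ +] sE; rewrite sE pairing0 ltxx. Qed.

Lemma qform_sum la (s : seq wt) : qform la (wsum s) = \sum_(b <- s) qform la b.
Proof.
rewrite /qform exchange_big; apply: eq_bigr => be _.
by rewrite pairing_sum mulr_sumr.
Qed.

(** By [qform_root] the positive number [qform v v], with [v] the sum of [t], is a
    combination of the pairings with positive coefficients. *)
Lemma simple_sum_pairing (t : seq wt) : t != [::] ->
  (forall a, a \in t -> simple_root a) ->
  exists2 a, a \in t & 0 < pairing (wsum t) a.
Proof.
move=> t0 tS; have tD : {subset t <= Dp} by move=> a /tS[].
have [ga gaD ga0] := pos_sum_pairing t0 tD.
set v := wsum t in ga0 *.
have vr be : is_root be -> pairing v be \is Num.real.
  move=> rb; rewrite pairing_sum big_seq rpred_sum // => a /tD aD.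
  by rewrite pairing_real //; exact: root_pos.
have q0 : 0 < qform v v.
  have gR : ga \in roots by rewrite mem_cat gaD.
  rewrite /qform (big_rem _ gR) /=; apply: ltr_wpDr; last exact: mulr_gt0.
  rewrite big_seq sumr_ge0 // => be /mem_rem/mem_roots rb.
  by rewrite -expr2 real_exprn_even_ge0 // vr.
have ra a : a \in t -> is_root a by move/tD/root_pos.
have [||a at0 a_pos] := @sum_lt0_ex _ t (fun a => - (2 * qform v a)).
- by move=> a /ra aR; rewrite realN qform_root // realM ?vr ?gtr0_real ?qform_gt0.
- by rewrite sumrN -mulr_sumr -qform_sum oppr_lt0; apply: mulr_gt0.
exists a => //; move: a_pos; rewrite oppr_lt0 qform_root; last exact: ra.
by rewrite pmulr_lgt0 // qform_gt0 //; exact: ra.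
Qed.

(** Subtract from [t] a simple root that pairs positively with the common sum:
    some root of [s] pairs positively with it too, and that root either equals
    it or stays positive after the subtraction. *)
Lemma simple_sum_refine (s t : seq wt) : {subset s <= Dp} ->
  (forall a, a \in t -> simple_root a) -> wsum s = wsum t ->
  (size s <= size t)%N /\
  forall b, b \in s -> exists2 u, {subset u <= t} & b = wsum u.
Proof.
elim: {t}_.+1 {-2}t (ltnSn (size t)) s => // n IH t tn s sD tS st.
have [s0|s0] := eqVneq s [::]; first by rewrite s0.
have [t0|t0] := eqVneq t [::].
  by case: (pos_sum_neq0 s0 sD); rewrite st t0 big_nil.
have [a a_t a_pos] := simple_sum_pairing t0 tS.
have [aD a_indec] := tS a a_t; have ra := root_pos aD.
have [||b bs b_pos] := @sum_lt0_ex _ s (fun b => - pairing b a).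
- by move=> b /sD/root_pos rb; rewrite rpredN pairing_real.
- by rewrite sumrN -pairing_sum st oppr_lt0.
rewrite oppr_lt0 in b_pos; have bD := sD b bs.
have t'S c : c \in rem a t -> simple_root c by move/mem_rem/tS.
have t'n : (size (rem a t) < n)%N by rewrite size_rem //; case: (t) t0 tn.
have t_gt0 : (0 < size t)%N by case: (t) t0.
have s_gt0 : (0 < size s)%N by case: (s) s0.
have tE : wsum t = a + wsum (rem a t) by rewrite (big_rem _ a_t).
have sE : wsum s = b + wsum (rem b s) by rewrite (big_rem _ bs).
have remP c : c \in s -> c = b \/ c \in rem b s.
  by rewrite (perm_mem (perm_to_rem bs)) inE => /orP[/eqP|]; [left|right].
have [ba|/eqP ba] := eqVneq b a.
  have [||//||] := IH (rem a t) _ (rem b s) => //.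
  - by move=> c /mem_rem/sD.
  - by move: st; rewrite tE sE ba => /addrI.
  rewrite !size_rem // => sz H; split; first by rewrite -(prednK s_gt0) -(prednK t_gt0).
  move=> c /remP[->|/H[u uS ->]].
    by exists [:: a]; rewrite ?big_seq1 // => d; rewrite inE => /eqP->.
  by exists u => // d /uS/mem_rem.
have b'D : b - a \in Dp.
  have ba0 : b - a <> 0 by move/eqP; rewrite subr_eq0 => /eqP.
  have /(pos_cover DpP)[//|] := pairing_gt0 (root_pos bD) ra b_pos ba0.
  by rewrite opprB => abD; case: a_indec; exists b, (a - b); split=> //; rewrite addrC subrK.
have [||//||] := IH (rem a t) _ ((b - a) :: rem b s) => //.
- by move=> c; rewrite inE => /orP[/eqP->//|/mem_rem/sD].
- by apply: (addrI a); rewrite -tE -st sE big_cons addrA [a + _]addrC subrK.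
rewrite /= !size_rem // prednK // => sz H; split; first by rewrite -(prednK t_gt0) (leq_trans sz).
move=> c /remP[->|cs].
  have [|u uS uE] := H (b - a); first exact: mem_head.
  exists (a :: u); last by rewrite big_cons -uE addrC subrK.
  by move=> d; rewrite inE => /orP[/eqP->//|/uS/mem_rem].
have [|u uS uE] := H c; first by rewrite inE cs orbT.
by exists u => // d /uS/mem_rem.
Qed.

(** Induction on the number of positive roots below [b]; the order on the roots
    is strict by [pos_sum_neq0]. *)
Lemma pos_root_simple_sum b : b \in Dp ->
  exists2 t : seq wt, (forall a, a \in t -> simple_root a) & b = wsum t.
Proof.
pose below b := [seq c <- (Dp : seq wt) | `[< exists s : seq wt,
  [/\ s != [::], {subset s <= Dp} & b = c + wsum s] >]].
elim: {b}_.+1 {-2}b (ltnSn (size (below b))) => // n IH b bn bD.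
have [bS|/not_andP[//|]] := EM (simple_root b).
  by exists [:: b]; rewrite ?big_seq1 // => a; rewrite inE => /eqP->.
move=> /contrapT[c [d [cD dD bE]]].
have below_lt x y : x \in Dp -> y \in Dp -> b = x + y -> (size (below x) < size (below b))%N.
  move=> xD yD xyE; have := @uniq_leq_size _ (x :: below x) (below b).
  apply.
    rewrite /= filter_uniq ?fset_uniq // andbT mem_filter xD andbT.
    apply/asboolP => -[s [s0 sD /esym/eqP]]; rewrite -subr_eq0 addrC addKr => /eqP.
    exact: pos_sum_neq0.
  move=> z; rewrite inE !mem_filter => /orP[/eqP->|/andP[/asboolP[s [s0 sD xE]] ->]].
    rewrite xD andbT; apply/asboolP; exists [:: y]; rewrite big_seq1; split=> //.
    by move=> w; rewrite inE => /eqP->.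
  rewrite andbT; apply/asboolP; exists (y :: s); split=> //.
    by move=> w; rewrite inE => /orP[/eqP->|/sD].
  by rewrite big_cons xyE xE -addrA [wsum s + y]addrC.
have [t tS tE] := IH c (leq_trans (below_lt _ _ cD dD bE) bn) cD.
have [u uS uE] : exists2 t : seq wt, (forall a, a \in t -> simple_root a) & d = wsum t.
  by apply: IH => //; apply: (leq_trans (below_lt d c dD cD _) bn); rewrite addrC.
exists (t ++ u); last by rewrite big_cat /= -tE -uE.
by move=> a; rewrite mem_cat => /orP[/tS|/uS].
Qed.

Local Notation ncone := (nat_cone Dp).

Lemma nat_cone_posD la mu : nat_cone_pos Dp la -> ncone mu ->
  nat_cone_pos Dp (la + mu).
Proof.
move=> [/nat_coneP[s sD ->] la0] /nat_coneP[t tD ->]; rewrite -big_cat /=.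
have uD : {subset s ++ t <= Dp} by move=> a; rewrite mem_cat => /orP[/sD|/tD].
split; first by apply/nat_coneP; exists (s ++ t).
apply: pos_sum_neq0 => //; move: la0; case: (s) => //.
by rewrite big_nil.
Qed.

Lemma pos_root_cone b : b \in Dp -> nat_cone_pos Dp b.
Proof. by move=> bD; split; [exact: nat_cone_mem | exact/root_neq0/root_pos]. Qed.

Lemma nat_cone_pos_pairing la : nat_cone_pos Dp la ->
  exists2 ga, ga \in Dp & ip la ga != 0.
Proof.
move=> [/nat_coneP[s sD ->] la0].
have s0 : s != [::] by apply/eqP => s0; apply: la0; rewrite s0 big_nil.
have [ga gaD ga0] := pos_sum_pairing s0 sD; exists ga => //; apply/eqP => ip0.
by move: ga0; rewrite /pairing ip0 mulr0 mul0r ltxx.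
Qed.

(** By [simple_sum_refine], the length of an expansion of [la] into simple roots
    is such a bound. *)
Lemma nat_cone_bound la : ncone la -> exists N, forall s : seq wt,
  {subset s <= Dp} -> ncone (la - wsum s) -> (size s <= N)%N.
Proof.
have simpl_sum la' : ncone la' ->
    exists2 t, (forall a, a \in t -> simple_root a) & la' = wsum t.
  case/nat_coneP=> s sD ->; elim: s sD => [|b s IH] sD; first by exists [::].
  have [|t tS tE] := IH; first by move=> c cs; apply: sD; rewrite inE cs orbT.
  have [|u uS uE] := @pos_root_simple_sum b; first by apply: sD; rewrite mem_head.
  exists (u ++ t); last by rewrite big_cons big_cat /= -tE -uE.
  by move=> a; rewrite mem_cat => /orP[/uS|/tS].
move/simpl_sum=> [t tS ->]; exists (size t) => s sD /nat_coneP[r rD rE].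
have [||+ _] := @simple_sum_refine (s ++ r) t _ tS.
- by move=> a; rewrite mem_cat => /orP[/sD|/rD].
- by rewrite big_cat /= -rE addrC subrK.
by rewrite size_cat; apply: leq_trans; rewrite leq_addr.
Qed.

Section LeviCone.
Variable Pil : {fset wt}.
Hypothesis PilP : forall al, al \in Pil -> simple_root al.
Local Notation lcone := (nat_cone (levi_roots Dp Pil)).

Lemma mem_levi_roots la :
  (la \in levi_roots Dp Pil) = (la \in Dp) && `[< nat_cone Pil la >].
Proof. by rewrite in_fset inE. Qed.

Lemma levi_coneP la : lcone la <-> nat_cone Pil la.
Proof.
split=> /nat_coneP[s sP ->]; apply: nat_cone_sum => a /sP.
  by rewrite mem_levi_roots => /andP[_ /asboolP].
move=> aP; apply: nat_cone_mem; rewrite mem_levi_roots /=; case: (PilP aP) => -> _ /=.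
by apply/asboolP/nat_cone_mem.
Qed.

(** [simple_sum_refine] expands the positive roots that make up [la] and [mu]
    into the simple roots that occur in [la + mu]. *)
Lemma levi_cone_face la mu : ncone la -> ncone mu ->
  lcone (la + mu) <-> lcone la /\ lcone mu.
Proof.
move=> laD muD; split=> [|[]]; last exact: nat_coneD.
suff face la' mu' : ncone la' -> ncone mu' -> lcone (la' + mu') -> lcone la'.
  by move=> lm; split; [apply: (face la mu) | apply: (face mu la) => //; rewrite addrC].
move=> /nat_coneP[s sD ->] /nat_coneP[t tD ->] /levi_coneP/nat_coneP[u uP uE].
have [||_ H] := @simple_sum_refine (s ++ t) u _ (fun a au => PilP (uP a au)).
- by move=> a; rewrite mem_cat => /orP[/sD|/tD].
- by rewrite big_cat.
apply: nat_cone_sum => a a_s; have [|v vu ->] := H a; first by rewrite mem_cat a_s.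
by apply/levi_coneP/nat_cone_sum => b /vu/uP/nat_cone_mem.
Qed.

End LeviCone.

(** * Dual bases of g *)

Lemma e_root_space b : b \in Dp -> root_space b (e b).
Proof. by move=> bD; case: (e_root efP bD). Qed.

Lemma f_root_space b : b \in Dp -> root_space (- b) (f b).
Proof. exact: (f_root efP). Qed.

Lemma lie_ef b : b \in Dp -> lie (e b) (f b) = vsval (hv b).
Proof.
move=> bD; rewrite (lie_opposite (e_root_space bD) (f_root_space bD)).
by rewrite (ef_pairing efP bD) scale1r.
Qed.

Lemma root_space_e b v : b \in Dp -> root_space b v -> v = B v (f b) *: e b.
Proof.
move=> bD; apply: root_space_line; [exact: root_pos | exact: e_root_space |
  exact: f_root_space | exact: (ef_pairing efP)].
Qed.

Lemma root_space_f b v : b \in Dp -> root_space (- b) v -> v = B v (e b) *: f b.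
Proof.
move=> bD; apply: root_space_line; [exact/root_opp/root_pos | exact: f_root_space | |].
  by rewrite opprK; apply: e_root_space.
by rewrite form_sym (ef_pairing efP).
Qed.

Local Notation hbasis := (vbasis {: subvs_of h}).

(** The basis of [h] dual to [hbasis] for the form [B]. *)
Definition hdual (i : 'I_(\dim {: subvs_of h})) : subvs_of h :=
  hv (linfun (coord hbasis i : subvs_of h -> K^o)).

Lemma hdual_form i a : B (vsval (hdual i)) (vsval a) = coord hbasis i a.
Proof. by rewrite hvP lfunE. Qed.

Lemma hbasis_expand (a : subvs_of h) :
  a = \sum_(i < \dim {: subvs_of h}) B (vsval a) (vsval (hdual i)) *: hbasis`_i.
Proof.
rewrite {1}(coord_vbasis (memvf a)); apply: eq_bigr => i _.
by rewrite form_sym hdual_form.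
Qed.

Lemma hdual_expand (a : subvs_of h) :
  a = \sum_(i < \dim {: subvs_of h}) B (vsval a) (vsval hbasis`_i) *: hdual i.
Proof.
apply: form_cartan_inj => c; rewrite [in LHS](hbasis_expand c) !linear_sum /=.
rewrite -[RHS]applyrE linear_sum /=; apply: eq_bigr => i _.
rewrite !linearZ /= linearZl_LR /= hdual_form mulrC.
by rewrite -[in RHS](hdual_form i c) (form_sym (vsval c)).
Qed.

(** The basis of [g] made of [hbasis] and the root vectors, each element paired
    with the element of the [B]-dual basis. *)
Definition dual_pairs : seq (g * g) :=
  [seq (vsval hbasis`_i, vsval (hdual i)) | i : 'I_(\dim {: subvs_of h})] ++
  ([seq (e b, f b) | b <- (Dp : seq wt)] ++ [seq (f b, e b) | b <- (Dp : seq wt)]).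

Lemma big_dual_pairs (W : nmodType) (F : g * g -> W) :
  \sum_(p <- dual_pairs) F p =
  \sum_(i < \dim {: subvs_of h}) F (vsval hbasis`_i, vsval (hdual i)) +
  (\sum_(b <- Dp) F (e b, f b) + \sum_(b <- Dp) F (f b, e b)).
Proof. by rewrite !big_cat /= big_image /= !big_map. Qed.

Lemma cartan_root_orth (a : subvs_of h) b v : b <> 0 -> root_space b v ->
  B (vsval a) v = 0.
Proof.
move=> b0 bv; apply: (root_space_orth (al := 0)) bv _; last by rewrite add0r.
by apply/(root_space0 h_cartan)/subvsP.
Qed.

(** By linearity [z] may be taken in [h] or among the root vectors, where all but
    one of the pairings vanish because weight spaces are orthogonal unless their
    weights are opposite. *)
Lemma dual_pairs_expand z :
  z = \sum_(p <- dual_pairs) B z p.2 *: p.1 /\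
  z = \sum_(p <- dual_pairs) B z p.1 *: p.2.
Proof.
have D0 b : b \in Dp -> b <> 0 by move/root_pos/root_neq0.
have N0 b : b \in Dp -> - b <> 0 by move=> /D0 b0 /eqP; rewrite oppr_eq0 => /eqP.
have ee b c : b \in Dp -> c \in Dp -> B (e b) (e c) = 0.
  move=> bD cD; apply: root_space_orth (e_root_space bD) (e_root_space cD) _.
  by case: (nat_cone_posD (pos_root_cone bD) (nat_cone_mem cD)).
have ff b c : b \in Dp -> c \in Dp -> B (f b) (f c) = 0.
  move=> bD cD; apply: root_space_orth (f_root_space bD) (f_root_space cD) _.
  case: (nat_cone_posD (pos_root_cone bD) (nat_cone_mem cD)) => _ + /eqP.
  by rewrite -opprD oppr_eq0 => + /eqP.
have ef b c : b \in Dp -> c \in Dp -> B (e b) (f c) = (b == c)%:R.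
  move=> bD cD; case: eqP => [<-|bc]; first exact: (ef_pairing efP).
  apply: root_space_orth (e_root_space bD) (f_root_space cD) _.
  by move/eqP; rewrite subr_eq0 => /eqP.
have sum_eq (G : wt -> g) c : c \in Dp -> \sum_(b <- Dp) (c == b)%:R *: G b = G c.
  move=> cD; rewrite (big_rem _ cD) /= eqxx scale1r big_seq big1 ?addr0 // => b.
  by rewrite (mem_rem_uniq _ (fset_uniq _)) inE eq_sym => /andP[/negPf-> _]; rewrite scale0r.
have sum0 (F : wt -> K) G : (forall b, b \in Dp -> F b = 0) ->
    \sum_(b <- Dp) F b *: G b = 0 :> g.
  by move=> F0; rewrite big_seq big1 // => b bD; rewrite F0 // scale0r.
have hsum0 (F : 'I_(\dim {: subvs_of h}) -> K) G : (forall i, F i = 0) ->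
    \sum_i F i *: G i = 0 :> g.
  by move=> F0; rewrite big1 // => i _; rewrite F0 scale0r.
have orthE b (a : subvs_of h) : b \in Dp -> B (e b) (vsval a) = 0.
  by move=> bD; rewrite form_sym; apply: cartan_root_orth (D0 _ bD) (e_root_space bD).
have orthF b (a : subvs_of h) : b \in Dp -> B (f b) (vsval a) = 0.
  by move=> bD; rewrite form_sym; apply: cartan_root_orth (N0 _ bD) (f_root_space bD).
pose Q z := z = \sum_(p <- dual_pairs) B z p.2 *: p.1 /\
  z = \sum_(p <- dual_pairs) B z p.1 *: p.2.
have QD x y : Q x -> Q y -> Q (x + y).
  move=> [x1 x2] [y1 y2]; split; [rewrite {1}x1 {1}y1|rewrite {1}x2 {1}y2];
    by rewrite -big_split; apply: eq_bigr => p _; rewrite linearDl scalerDl.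
have QZ c x : Q x -> Q (c *: x).
  move=> [x1 x2]; split; [rewrite {1}x1|rewrite {1}x2];
    by rewrite scaler_sumr; apply: eq_bigr => p _; rewrite linearZl_LR scalerA.
have Q0 : Q 0 by split; rewrite big1 // => p _; rewrite linear0l scale0r.
have Qh (a : subvs_of h) : Q (vsval a).
  have aE b : b \in Dp -> B (vsval a) (e b) = 0 by move=> bD; rewrite form_sym orthE.
  have aF b : b \in Dp -> B (vsval a) (f b) = 0 by move=> bD; rewrite form_sym orthF.
  split; rewrite big_dual_pairs /= !sum0 // !addr0.
    by rewrite {1}(hbasis_expand a) linear_sum; apply: eq_bigr => i _; rewrite linearZ.
  by rewrite {1}(hdual_expand a) linear_sum; apply: eq_bigr => i _; rewrite linearZ.
have Qe b : b \in Dp -> Q (e b).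
  move=> bD; have F c : c \in Dp -> B (e b) (f c) = (b == c)%:R by exact: ef.
  split; rewrite big_dual_pairs /= hsum0 ?add0r; try (by move=> i; exact: orthE).
    rewrite [X in _ + X]sum0 ?addr0; last by move=> c; apply: ee.
    by rewrite -[LHS](sum_eq e) //; apply: eq_big_seq => c cD; rewrite F.
  rewrite [X in X + _]sum0 ?add0r; last by move=> c; apply: ee.
  by rewrite -[LHS](sum_eq e) //; apply: eq_big_seq => c cD; rewrite F.
have Qf b : b \in Dp -> Q (f b).
  move=> bD; have F c : c \in Dp -> B (f b) (e c) = (b == c)%:R.
    by move=> cD; rewrite form_sym ef // eq_sym.
  split; rewrite big_dual_pairs /= hsum0 ?add0r; try (by move=> i; exact: orthF).
    rewrite [X in X + _]sum0 ?add0r; last by move=> c; apply: ff.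
    by rewrite -[LHS](sum_eq f) //; apply: eq_big_seq => c cD; rewrite F.
  rewrite [X in _ + X]sum0 ?addr0; last by move=> c; apply: ff.
  by rewrite -[LHS](sum_eq f) //; apply: eq_big_seq => c cD; rewrite F.
have [be [v [vbe ->]]] := root_space_sum lieP h_cartan z; rewrite -/(Q _).
apply: (big_ind Q) => // i _.
have [->//|/eqP v0] := eqVneq (v i) 0.
have [b0|/eqP b0] := eqVneq (be i) 0.
  have vh : v i \in h by apply/(root_space0 h_cartan); rewrite -b0.
  exact: (Qh (Subvs vh)).
have /(pos_cover DpP)[bD|bD] : is_root (be i) by split=> //; exists (v i).
  by rewrite (root_space_e bD (vbe i)); apply/QZ/Qe.
by rewrite (root_space_f bD (v := v i)) ?opprK //; apply/QZ/Qf.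
Qed.

(** * The denominators of psi *)

Variables (U : algType K) (iota : {linear g -> U}).
Hypothesis U_env : enveloping_algebra lie iota.
Variables (U' : unitAlgType K) (j : {lrmorphism U -> U'}).
Hypothesis U'_loc : ore_localization (in_S h iota) j.
Variable shift : wt -> U' -> U'.
Hypothesis shiftP : forall la, is_shift iota j la (shift la).

Local Notation U'h := (in_U'h h iota j).
Local Notation H a := (j (iota (vsval (a : subvs_of h)))).
Local Notation psi := (psi B iota j Dp hv).

Lemma iota_comm (a b : subvs_of h) : GRing.comm (iota (vsval a)) (iota (vsval b)).
Proof.
apply/eqP; rewrite -subr_eq0 -(env_lie U_env).
by rewrite (cartan_abelian h_cartan) ?subvsP // linear0.
Qed.

Let U'C := U'h_comm iota_comm (j := j).
Let U'D := U'hD iota_comm U'_loc.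
Let U'M := U'hM iota_comm U'_loc.
Let U'V := U'hV U'_loc.
Let U'N := U'hN iota_comm U'_loc.

Lemma shift_shift la mu x : U'h x -> shift la (shift mu x) = shift (la + mu) x.
Proof.
move=> xh; have cP := shift_comp (shiftP la) (shiftP mu).
exact: (shift_ext U'_loc cP (shiftP (la + mu)) xh).
Qed.

Lemma shift_at0 x : U'h x -> shift 0 x = x.
Proof.
move=> xh; exact: (shift_ext U'_loc (shiftP 0) (shift_id h iota j) xh).
Qed.

(** The denominator [D la] of [psi la]. *)
Definition dpsi (la : wt) : U' :=
  H (hv la) + (ip (half_sum Dp) la + 2^-1 * ip la la)%:A.

Lemma U'h_dpsi la : U'h (dpsi la).
Proof. by apply: U'D; [exact: U'h_gen | exact: U'h_scalar]. Qed.

Lemma U'h_psi la : U'h (psi la).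
Proof. exact/U'V/U'h_dpsi. Qed.

Lemma dpsiD la mu : dpsi (la + mu) = dpsi la + dpsi mu + (ip la mu)%:A.
Proof.
rewrite /dpsi hvD !linearD /= addrACA -!addrA; congr (_ + (_ + _)).
rewrite -!scalerDl; congr (_ *: _).
by rewrite ipDr ipDl !ipDr (ip_sym mu la); field.
Qed.

Lemma shift_dpsi la mu : shift la (dpsi mu) = dpsi mu + (ip la mu)%:A.
Proof.
rewrite (shift_add (shiftP la)); [|exact: U'h_gen|exact: U'h_scalar].
rewrite (shift_gen (shiftP la)) (shift_scalar (shiftP la)) -ip_eval.
by rewrite addrAC.
Qed.

(** In the adjoint representation [h_la] acts by a scalar only if all roots
    vanish on it. *)
Lemma dpsi_unit la : nat_cone_pos Dp la -> dpsi la \is a GRing.unit.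
Proof.
move=> laP; set c := ip (half_sum Dp) la + 2^-1 * ip la la.
have -> : dpsi la = j (iota (vsval (hv la)) + c%:A).
  by rewrite rmorphD /= env_map_scalar.
apply: (loc_unit U'_loc); split; first by apply: Uh_add; [apply: Uh_gen | apply: Uh_scalar].
move/eqP; rewrite addr_eq0 -scaleNr => /eqP /(env_scalar_central lieP U_env)[_ hc].
have [ga gaD] := nat_cone_pos_pairing laP; rewrite ip_sym ip_eval.
have := hc (e ga); rewrite (e_root_space gaD (hv la)) => /eqP; rewrite scaler_eq0.
by case/orP=> [->//|/eqP e0]; case: (e_root efP gaD).
Qed.

Lemma shift_psi la mu : nat_cone_pos Dp mu ->
  shift la (dpsi mu) \is a GRing.unit /\ shift la (psi mu) = (shift la (dpsi mu))^-1.
Proof.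
by move=> muP; exact: (shift_unit U'_loc (shiftP la) (U'h_dpsi mu) (dpsi_unit muP)).
Qed.

Lemma U'h_shift la x : U'h x -> U'h (shift la x).
Proof. exact: (shift_stable (shiftP la)). Qed.

Lemma U'h_prod (I : Type) (r : seq I) (P : pred I) (F : I -> U') :
  (forall i, U'h (F i)) -> U'h (\prod_(i <- r | P i) F i).
Proof.
move=> Fh; apply: big_ind => //; exact: U'h1.
Qed.

Lemma shift_prod la (I : Type) (r : seq I) (P : pred I) (F : I -> U') :
  (forall i, U'h (F i)) ->
  shift la (\prod_(i <- r | P i) F i) = \prod_(i <- r | P i) shift la (F i).
Proof.
move=> Fh; elim: r => [|i r IH]; first by rewrite !big_nil (shift_one (shiftP la)).
rewrite !big_cons; case: (P i) => //.
by rewrite (shift_mul (shiftP la)) ?IH //; exact: U'h_prod.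
Qed.

Lemma shift_sum la (I : Type) (r : seq I) (F : I -> U') :
  (forall i, U'h (F i)) ->
  shift la (\sum_(i <- r) F i) = \sum_(i <- r) shift la (F i).
Proof.
have Sh s F' : (forall i, U'h (F' i)) -> U'h (\sum_(i <- s) F' i : U').
  move=> Fh; apply: big_ind => //; exact: U'h0.
move=> Fh; elim: r => [|i r IH]; first by rewrite !big_nil (shift0 (shiftP la)).
by rewrite !big_cons (shift_add (shiftP la)) ?IH //; exact: Sh.
Qed.

Lemma shift_sign la n x : U'h x -> shift la ((-1) ^+ n * x) = (-1) ^+ n * shift la x.
Proof.
move=> xh; elim: n => [|n IH]; first by rewrite !mul1r.
rewrite !exprS -!mulrA !mulN1r (shiftN (shiftP la)) ?IH //.
by rewrite -signr_odd mulr_sign; case: (odd n); [exact: U'N | exact: xh].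
Qed.

(** With [D = 1 / psi], both identities are partial fraction decompositions
    coming from [D (la + mu) = D la + (D mu)^la]. *)
Lemma psi_split la mu : nat_cone_pos Dp la -> nat_cone_pos Dp mu ->
  psi (la + mu) * shift la (psi mu) = psi la * (shift la (psi mu) - psi (la + mu)).
Proof.
move=> laP muP; have lmP := nat_cone_posD laP muP.1.
have ua := dpsi_unit lmP; have ud := dpsi_unit laP.
have [ub bE] := shift_psi la muP.
have hb : U'h (shift la (dpsi mu)) by apply/U'h_shift/U'h_dpsi.
have bC := U'C (U'h_dpsi la) hb.
have aE : dpsi (la + mu) = dpsi la + shift la (dpsi mu).
  by rewrite dpsiD shift_dpsi; exact/esym/addrA.
rewrite bE; exact: inv_sum_split.
Qed.

Lemma psi_cancel la mu : nat_cone_pos Dp la -> ncone mu ->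
  shift (- la) (psi la) * shift (- la) (psi (la + mu)) * dpsi mu =
  shift (- la) (psi la) - shift (- la) (psi (la + mu)).
Proof.
move=> laP muP; have lmP := nat_cone_posD laP muP.
have [ud dE] := shift_psi (- la) laP; have [ua aE] := shift_psi (- la) lmP.
have hd : U'h (shift (- la) (dpsi la)) by apply/U'h_shift/U'h_dpsi.
have ha : U'h (shift (- la) (dpsi (la + mu))) by apply/U'h_shift/U'h_dpsi.
have daC := U'C hd ha.
have mE : dpsi mu = shift (- la) (dpsi (la + mu)) - shift (- la) (dpsi la).
  apply/esym/eqP; rewrite subr_eq; apply/eqP; rewrite !shift_dpsi dpsiD.
  have -> : ip (- la) la = ip la mu + ip (- la) (la + mu).
    by rewrite !ipNl ipDr opprD addrCA subrr addr0.
  by rewrite scalerDl [dpsi la + dpsi mu]addrC -!addrA.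
rewrite dE aE mE; exact: inv_diff_cancel.
Qed.

(** * The coefficients and their closed form *)

Variable Pil : {fset wt}.
Hypothesis PilP : forall al, al \in Pil -> simple_root al.

Local Notation Dpl := (levi_roots Dp Pil).
Local Notation lcone := (nat_cone Dpl).
Local Notation delta := (delta_cone U' Dpl).
Local Notation coef := (proj_coef Dpl psi shift).

Lemma delta_in la : lcone la -> delta la = 1.
Proof. by move=> laP; rewrite /delta_cone asboolT. Qed.

Lemma delta_out la : ~ lcone la -> delta la = 0.
Proof. by move=> laP; rewrite /delta_cone asboolF. Qed.

Lemma coef1 b : coef [:: b] = (- 1 + delta b) * psi b.
Proof. by []. Qed.

Lemma coef_cons b c s : coef [:: b, c & s] =
  - psi b * coef (b + c :: s) + delta b * psi b * shift b (coef (c :: s)).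
Proof. by []. Qed.

Lemma U'h_delta b : U'h (delta b).
Proof. by rewrite /delta_cone; case: asbool; [exact: U'h1 | exact: U'h0]. Qed.

Lemma U'h_coef s : U'h (coef s).
Proof.
case: s => [|b s]; first exact: U'h1.
elim: s b => [|c s IH] b.
  rewrite coef1; apply: U'M (U'h_psi b); apply: U'D (U'h_delta b).
  by apply: U'N; exact: U'h1.
rewrite coef_cons; apply: U'D; first by apply: U'M (IH _); apply/U'N/U'h_psi.
by apply: U'M; [apply: U'M; [exact: U'h_delta | exact: U'h_psi] | exact/U'h_shift/IH].
Qed.

Lemma coef_levi s : (0 < size s)%N -> (forall b, b \in s -> lcone b) -> coef s = 0.
Proof.
case: s => // b s _; elim: s b => [|c s IH] b sL.
  by rewrite coef1 delta_in ?addNr ?mul0r //; apply: sL; rewrite mem_head.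
have [bL cL] : lcone b /\ lcone c by split; apply: sL; rewrite !inE eqxx ?orbT.
have sL' d : d \in s -> lcone d by move=> ds; apply: sL; rewrite !inE ds !orbT.
rewrite coef_cons !IH ?mulr0 ?(shift0 (shiftP b)) ?mulr0 ?addr0 //.
  by move=> d; rewrite inE => /orP[/eqP->|/sL'].
by move=> d; rewrite inE => /orP[/eqP->|/sL'//]; apply: nat_coneD.
Qed.

Local Notation closed_term := (closed_term psi shift).

(** The two groups of factors of [closed_term s k]. *)
Definition inner_psis (s : seq wt) (k : nat) : U' :=
  \prod_(0 <= i < k) shift (seg_sum s 0 i) (psi (seg_sum s i k)).

Definition outer_psis (s : seq wt) (k : nat) : U' :=
  \prod_(k <= i < size s) shift (seg_sum s 0 k) (psi (seg_sum s k i.+1)).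

Lemma closed_termE s k :
  closed_term s k = (- 1) ^+ (size s - k) * (inner_psis s k * outer_psis s k).
Proof. by []. Qed.

Lemma seg_sum_nil (s : seq wt) i : seg_sum s i i = 0.
Proof. by rewrite /seg_sum big_geq. Qed.

Lemma seg_sum_cons (b : wt) s k : seg_sum (b :: s) 0 k.+1 = b + seg_sum s 0 k.
Proof. by rewrite /seg_sum big_nat_recl. Qed.

Lemma seg_sum_consS (b : wt) s i k : seg_sum (b :: s) i.+1 k.+1 = seg_sum s i k.
Proof. by rewrite /seg_sum big_add1. Qed.

Lemma seg_sum_merge (b c : wt) s k :
  seg_sum (b + c :: s) 0 k.+1 = seg_sum [:: b, c & s] 0 k.+2.
Proof. by rewrite !seg_sum_cons addrA. Qed.

Lemma U'h_inner s k : U'h (inner_psis s k).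
Proof. by apply: U'h_prod => i; exact/U'h_shift/U'h_psi. Qed.

Lemma U'h_outer s k : U'h (outer_psis s k).
Proof. by apply: U'h_prod => i; exact/U'h_shift/U'h_psi. Qed.

Lemma U'h_closed_term s k : U'h (closed_term s k).
Proof.
rewrite closed_termE -signr_odd mulr_sign.
have ioh : U'h (inner_psis s k * outer_psis s k).
  by apply: U'M; [exact: U'h_inner | exact: U'h_outer].
by case: odd => //; apply: U'N.
Qed.

Lemma outer_psis_cons b s k :
  outer_psis (b :: s) k.+1 = shift b (outer_psis s k).
Proof.
rewrite /outer_psis shift_prod => [|i]; last exact/U'h_shift/U'h_psi.
rewrite big_add1 /=; apply: eq_bigr => i _.
by rewrite seg_sum_consS seg_sum_cons shift_shift //; exact: U'h_psi.
Qed.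

Lemma inner_psis_cons b s k :
  inner_psis (b :: s) k.+1 = psi (b + seg_sum s 0 k) * shift b (inner_psis s k).
Proof.
rewrite /inner_psis big_nat_recl // seg_sum_nil seg_sum_cons shift_at0; last exact: U'h_psi.
rewrite shift_prod => [|i]; last exact/U'h_shift/U'h_psi.
congr (_ * _); apply: eq_bigr => i _.
by rewrite seg_sum_consS seg_sum_cons shift_shift //; exact: U'h_psi.
Qed.

Lemma closed_term_merge0 b c s :
  closed_term [:: b, c & s] 0 = - psi b * closed_term (b + c :: s) 0.
Proof.
rewrite !closed_termE !subn0 /inner_psis !big_geq // !mul1r.
rewrite /outer_psis !seg_sum_nil big_nat_recl // seg_sum_cons seg_sum_nil addr0.
rewrite shift_at0; last exact: U'h_psi.
rewrite /= exprS !mulN1r !mulNr; congr (- _).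
rewrite mulrA -(commr_sign (psi b)) -mulrA; congr (_ * (_ * _)).
by apply: eq_bigr => i _; rewrite seg_sum_merge.
Qed.

Lemma closed_term_cons1 b s :
  closed_term (b :: s) 1 = psi b * shift b (closed_term s 0).
Proof.
have oh := U'h_outer s 0.
rewrite !closed_termE inner_psis_cons outer_psis_cons /inner_psis !big_geq //.
rewrite mul1r (shift_one (shiftP b)) mulr1 subn0 subSS subn0 shift_sign //.
by rewrite seg_sum_nil addr0 !mulrA commr_sign.
Qed.

(** [psi_split] with the sum of the entries [1, ..., k + 1], counted from 0, in the
    role of the second weight. *)
Lemma closed_term_cons b c s k : (k <= size s)%N ->
  (forall d, d \in [:: b, c & s] -> nat_cone_pos Dp d) ->
  closed_term [:: b, c & s] k.+2 =
  psi b * shift b (closed_term (c :: s) k.+1) -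
  psi b * closed_term (b + c :: s) k.+1.
Proof.
move=> ks sP; set ga := c + seg_sum s 0 k.
have bP : nat_cone_pos Dp b by apply: sP; rewrite !inE eqxx.
have cP : nat_cone_pos Dp c by apply: sP; rewrite !inE eqxx orbT.
have gaP : nat_cone_pos Dp ga.
  apply: nat_cone_posD => //; rewrite /seg_sum big_nat.
  apply: big_ind => [|u v|i /andP[_ ik]]; [exact: nat_cone0 | exact: nat_coneD |].
  have /sP[] // : s`_i \in [:: b, c & s].
  by rewrite !inE mem_nth ?orbT // (leq_trans ik).
pose A := shift (b + c) (inner_psis s k); pose O := shift (b + c) (outer_psis s k).
have iE : shift b (inner_psis (c :: s) k.+1) = shift b (psi ga) * A.
  rewrite inner_psis_cons (shift_mul (shiftP b)) ?shift_shift //; first exact: U'h_inner.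
  - exact: U'h_psi.
  - exact/U'h_shift/U'h_inner.
have oE : shift b (outer_psis (c :: s) k.+1) = O.
  by rewrite outer_psis_cons shift_shift //; exact: U'h_outer.
rewrite !closed_termE shift_sign; last by apply: U'M; [exact: U'h_inner | exact: U'h_outer].
rewrite (shift_mul (shiftP b)); [|exact: U'h_inner | exact: U'h_outer].
rewrite [inner_psis [:: b, c & s] _]inner_psis_cons outer_psis_cons iE oE.
rewrite [inner_psis (b + c :: s) _]inner_psis_cons outer_psis_cons -/A -/O.
rewrite seg_sum_cons -/ga -addrA -/ga /= !subSS.
set n := (_ - _)%N; rewrite ![psi b * (_ * _)]mulrA !(commr_sign (psi b)) -!mulrA -mulrBr.
congr (_ * _); rewrite !mulrA psi_split // -!mulrA -mulrBr; congr (_ * _).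
by rewrite mulrBl.
Qed.

(** The terms [k = 0] and [k = 1] come from one half of the recursion each, every
    later term from both, by [closed_term_cons]. *)
Lemma coef_closed s m : (forall b, b \in s -> nat_cone_pos Dp b) ->
  (0 < m <= size s)%N -> (forall i, (i < m.-1)%N -> lcone s`_i) ->
  ~ lcone s`_m.-1 -> coef s = \sum_(0 <= k < m) closed_term s k.
Proof.
case: m => // m sP /=; case: s sP => // b s; elim: s b m => [|c s IH] b m sP.
  case: m => // _ _ bL; have {}bL : ~ lcone b by [].
  rewrite big_nat1 coef1 delta_out // addr0 closed_termE.
  rewrite /inner_psis /outer_psis big_geq // big_nat1 mul1r seg_sum_cons !seg_sum_nil addr0.
  by rewrite shift_at0 //; exact: U'h_psi.
have bP : nat_cone_pos Dp b by apply: sP; rewrite !inE eqxx.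
have cP : nat_cone_pos Dp c by apply: sP; rewrite !inE eqxx orbT.
have cs d : d \in c :: s -> nat_cone_pos Dp d by move=> ds; apply: sP; rewrite inE ds orbT.
have bcs d : d \in b + c :: s -> nat_cone_pos Dp d.
  rewrite inE => /orP[/eqP->|ds]; last by apply: cs; rewrite inE ds orbT.
  by apply: nat_cone_posD => //; case: cP.
have face := levi_cone_face PilP bP.1 cP.1.
rewrite coef_cons; case: m => [|m].
  move=> _ _ bL; have {}bL : ~ lcone b by [].
  rewrite delta_out // !mul0r addr0 big_nat1 closed_term_merge0.
  by rewrite (IH (b + c) 0%N) //= ?big_nat1 // => /face[].
move=> ms sL mL; have {}ms : (m < size (c :: s))%N by [].
have {}sL i : (i < m.+1)%N -> lcone [:: b, c & s]`_i by apply: sL.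
have {}mL : ~ lcone (c :: s)`_m by [].
have bL : lcone b by exact: (sL 0%N).
rewrite delta_in // mul1r (IH c m) //; first last.
  by move=> i im; apply: (sL i.+1).
have -> : coef (b + c :: s) = \sum_(0 <= k < m.+1) closed_term (b + c :: s) k.
  apply: IH => // [i im|].
    case: i im => [|i] im /=; last exact: (sL i.+2).
    by apply/face; split=> //; apply: (sL 1%N).
  case: m mL {ms sL} => [|m] //= mL; by move=> /face[_].
rewrite shift_sum => [|k]; last exact: U'h_closed_term.
rewrite !big_nat_recl //.
rewrite closed_term_merge0 closed_term_cons1.
rewrite [X in _ = _ + (_ + X)](eq_big_nat _ _ (F2 := fun k =>
  psi b * shift b (closed_term (c :: s) k.+1) -
  psi b * closed_term (b + c :: s) k.+1)); last first.
  by move=> k /andP[_ km]; apply: closed_term_cons => //; rewrite (leq_trans (ltnW km)).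
rewrite big_split sumrN -!mulr_sumr /= !mulrDr !mulNr -!addrA; congr (_ + _).
by rewrite addrC -!addrA.
Qed.

(** * Weight vectors of the universal Verma module *)

Variables (M : lmodType U') (vac : M) (ract : M -> U' -> M).
Hypothesis M_verma : universal_verma lie iota j Dp vac ract.

Local Notation E b := (j (iota (e b))).
Local Notation F b := (j (iota (f b))).

Lemma env_bracket x y :
  j (iota x) * j (iota y) = j (iota y) * j (iota x) + j (iota (lie x y)).
Proof. by rewrite (env_lie U_env) rmorphB !rmorphM addrC subrK. Qed.

Lemma root_intertwine (al : wt) x : root_space al x ->
  forall phi, U'h phi -> j (iota x) * phi = shift (- al) phi * j (iota x).
Proof.
move=> xal; apply: (shift_intertwine U'_loc (shiftP (- al))) => a.
rewrite env_bracket (lie_skew lieP) xal mulrDl mulr_algl opp_lfunE.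
by rewrite -scaleNr !linearZ.
Qed.

Lemma f_intertwine b phi : b \in Dp -> U'h phi -> phi * F b = F b * shift (- b) phi.
Proof.
move=> bD phih; rewrite (root_intertwine (f_root_space bD)) ?opprK; last exact: U'h_shift.
by rewrite shift_shift // subrr shift_at0.
Qed.

(** The weight space [M_{- la}], described by generators: this has the inclusion
    of the weights of [M] in [- Q_+] built in ([piece_cone]) and lets statements
    on weight vectors be proved by induction. *)
Inductive verma_piece : wt -> M -> Prop :=
| piece_vac phi : U'h phi -> verma_piece 0 (phi *: vac)
| piece_f la m b : b \in Dp -> verma_piece la m -> verma_piece (la + b) (F b *: m)
| piece_add la m n : verma_piece la m -> verma_piece la n -> verma_piece la (m + n)
| piece_zero la : verma_piece la 0.

Lemma piece_cone la m : verma_piece la m -> m = 0 \/ ncone la.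
Proof.
elim=> {la m} [phi _|la m b bD _ [->|laD]|la m n _ [->|laD] _ [->|laD']|la].
- by right; exact: nat_cone0.
- by left; rewrite scaler0.
- by right; apply: nat_coneD => //; exact: nat_cone_mem.
- by left; rewrite addr0.
- by right.
- by right.
- by right.
- by left.
Qed.

Lemma piece_eq la mu m : la = mu -> verma_piece la m -> verma_piece mu m.
Proof. by move->. Qed.

Lemma piece_U'h la m phi : U'h phi -> verma_piece la m -> verma_piece la (phi *: m).
Proof.
move=> phih mP; elim: mP phi phih
  => {la m} [psi' psih|la m b bD mP IH|la m n _ IHm _ IHn|la] phi phih.
- by rewrite scalerA; apply/piece_vac/U'M.
- rewrite scalerA f_intertwine // -scalerA; apply: piece_f => //.
  exact/IH/U'h_shift.
- by rewrite scalerDr; apply: piece_add; [apply: IHm | apply: IHn].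
- by rewrite scaler0; apply: piece_zero.
Qed.

Lemma e_vac b : b \in Dp -> E b *: vac = 0.
Proof.
move=> bD; apply/(verma_ann M_verma); exists [:: (1, e b)]; last first.
  by rewrite big_seq1 mul1r.
move=> p; rewrite inE => /eqP-> /=.
exists (fun c => if c == b then e b else 0) => [c cD|].
  case: eqP => [->|_]; first exact: e_root_space.
  by move=> a; rewrite linear0r scaler0.
rewrite (big_rem _ bD) /= eqxx big_seq big1 ?addr0 // => c.
by rewrite (mem_rem_uniq _ (fset_uniq _)) inE => /andP[/negPf->].
Qed.

(** Commute [x] to the right past the [f_b]; on [vac] it gives 0 or a generator,
    and each commutator is a root vector applied to a shorter word. *)
Lemma piece_root al x la m : root_space al x -> verma_piece la m ->
  verma_piece (la - al) (j (iota x) *: m).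
Proof.
move=> xal mP; elim: mP al x xal
  => {la m} [phi phih|la m b bD mP IH|la m n _ IHm _ IHn|la] al x xal.
- rewrite scalerA (root_intertwine xal) // -scalerA.
  apply: piece_U'h; first exact: U'h_shift.
  have [->|/eqP x0] := eqVneq x 0; first by rewrite !linear0 scale0r; exact: piece_zero.
  have [al0|/eqP al0] := eqVneq al 0.
    have xh : x \in h by apply/(root_space0 h_cartan); rewrite -al0.
    rewrite al0 subr0; apply: piece_vac; exact: (U'h_gen iota j (Subvs xh)).
  have /(pos_cover DpP)[alD|alD] : is_root al by split=> //; exists x.
    rewrite (root_space_e alD xal) !linearZ /= -mulr_algl -scalerA e_vac // scaler0.
    exact: piece_zero.
  rewrite (root_space_f (b := - al) (v := x)) ?opprK // !linearZ /=.
  rewrite -mulr_algl -scalerA; apply: piece_U'h; first exact: U'h_scalar.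
  by rewrite -[vac]scale1r; apply: piece_f alD (piece_vac (U'h1 _ _ _)).
- rewrite scalerA env_bracket scalerDl -!scalerA; apply: piece_add.
    by rewrite addrAC; apply: piece_f => //; apply: IH.
  apply: (@piece_eq (la - (al - b))); first by rewrite opprB addrA addrAC.
  by apply: IH; apply: root_space_lie => //; exact: f_root_space.
- by rewrite scalerDr; apply: piece_add; [apply: IHm | apply: IHn].
- by rewrite scaler0; apply: piece_zero.
Qed.

Lemma piece_e la m b : b \in Dp -> verma_piece la m -> verma_piece (la - b) (E b *: m).
Proof. by move=> bD; apply/piece_root/e_root_space. Qed.

(** The sums of such vectors contain [vac] and are stable under [g], hence under
    [U(g)], and under the denominators in [U'(h)]. *)
Lemma verma_piece_sum (Q : M -> Prop) : Q 0 ->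
  (forall m n, Q m -> Q n -> Q (m + n)) ->
  (forall la m, verma_piece la m -> Q m) -> forall m, Q m.
Proof.
move=> Q0 QD Qp; pose spanned m := exists2 s : seq (wt * M),
  (forall p, p \in s -> verma_piece p.1 p.2) & m = \sum_(p <- s) p.2.
have spanned0 : spanned 0 by exists [::]; rewrite ?big_nil.
have spannedD m n : spanned m -> spanned n -> spanned (m + n).
  move=> [s sP ->] [t tP ->]; exists (s ++ t); last by rewrite big_cat.
  by move=> p; rewrite mem_cat => /orP[/sP|/tP].
have spanned_piece la m : verma_piece la m -> spanned m.
  by move=> mP; exists [:: (la, m)]; rewrite ?big_seq1 // => p; rewrite inE => /eqP->.
have lift x : (forall la m, verma_piece la m -> spanned (x *: m)) ->
    forall m, spanned m -> spanned (x *: m).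
  move=> xP m [s sP ->]; rewrite scaler_sumr big_seq.
  by apply: big_ind => // p ps; apply: xP (sP p ps).
have lift_g x : forall m, spanned m -> spanned (j (iota x) *: m).
  apply: lift => la m mP.
  have [be [v [vbe ->]]] := root_space_sum lieP h_cartan x.
  rewrite !linear_sum scaler_suml; apply: big_ind => // i _.
  exact: spanned_piece (piece_root (vbe i) mP).
have lift_U'h phi : U'h phi -> forall m, spanned m -> spanned (phi *: m).
  by move=> phih; apply: lift => la m mP; exact: spanned_piece (piece_U'h phih mP).
have lift_U u : forall m, spanned m -> spanned (j u *: m).
  elim: (enveloping_generated U_env u) => {u} [x|c|u v _ IHu _ IHv|u v _ IHu _ IHv] m mP.
  - exact: lift_g.
  - by rewrite env_map_scalar; apply: lift_U'h => //; exact: U'h_scalar.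
  - by rewrite rmorphD scalerDl; apply: spannedD; [apply: IHu | apply: IHv].
  - by rewrite rmorphM -scalerA; apply/IHu/IHv.
move=> m; suff [s sP ->] : spanned m by rewrite big_seq; apply: big_ind => // p /sP/Qp.
have [x ->] := verma_cyclic M_verma m.
have [s [u [[sh s0] ->]]] := loc_frac U'_loc x.
rewrite -scalerA; apply: lift_U'h; first exact/U'V/U'h_j.
apply: lift_U; rewrite -[vac]scale1r; apply: spanned_piece (piece_vac (U'h1 _ _ _)).
Qed.

Lemma ract_scale x m y : U'h y -> ract (x *: m) y = x *: ract m y.
Proof.
move=> yh; have [u ->] := verma_cyclic M_verma m.
by rewrite !scalerA !(verma_ract M_verma) // scalerA mulrA.
Qed.

Lemma ract_add m n y : U'h y -> ract (m + n) y = ract m y + ract n y.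
Proof.
move=> yh; have [u ->] := verma_cyclic M_verma m; have [v ->] := verma_cyclic M_verma n.
by rewrite -scalerDl !(verma_ract M_verma) // mulrDl scalerDl.
Qed.

Lemma piece_weight la m : verma_piece la m ->
  adjoint_weight_space iota j ract (- la) m.
Proof.
move=> mP a; rewrite opp_lfunE; set x := H a; have xh : U'h x by exact: U'h_gen.
suff -> : ract m x = x *: m + (la a : K)%:A *: m by rewrite opprD addrA subrr add0r !scaleNr.
elim: mP => {la m} [phi phih|la m b bD _ IH|la m n _ IHm _ IHn|la].
- by rewrite (verma_ract M_verma) // zero_lfunE scale0r scale0r addr0 scalerA (U'C phih xh).
- have xF : x * F b = F b * (x - (b a : K)%:A).
    by rewrite f_intertwine // (shift_gen (shiftP _)) opp_lfunE scaleNr.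
  rewrite ract_scale // IH (scalerA x) xF scalerA (scalarr_comm _ (F b)) -!scalerA -scalerDr.
  congr (_ *: _); rewrite -!scalerDl; congr (_ *: _); rewrite -addrA; congr (_ + _).
  by rewrite -scaleNr -scalerDl add_lfunE addrC addrK.
- by rewrite ract_add // IHm IHn !scalerDr addrACA.
- by rewrite -(scale0r vac) ract_scale // !scale0r !scaler0 addr0.
Qed.

(** * The action of the Casimir element *)

Local Notation Cas := (j (casimir iota dual_pairs)).
Local Notation hsum la := (\sum_(i < \dim {: subvs_of h})
  (H hbasis`_i + (la hbasis`_i : K)%:A) * (H (hdual i) + (la (hdual i) : K)%:A) +
  \sum_(b <- Dp) (H (hv b) + (la (hv b) : K)%:A)).

Lemma casimir_comm x : GRing.comm Cas (j (iota x)).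
Proof.
rewrite /GRing.comm -!rmorphM; congr (j _).
exact: (casimir_central lieP (form_invariant BP) (env_lie U_env) dual_pairs_expand).
Qed.

Lemma casimir_commU' phi : U'h phi -> GRing.comm Cas phi.
Proof.
have Cu u : in_Uh h iota u -> GRing.comm Cas (j u).
  elim=> {u} [a|c|u v _ IHu _ IHv|u v _ IHu _ IHv]; first exact: casimir_comm.
  - by rewrite env_map_scalar; apply/commr_sym/scalarr_comm.
  - by rewrite rmorphD; apply: commrD.
  - by rewrite rmorphM; apply: commrM.
move=> [s [u [[sh _] uh ->]]]; apply: commrM; last exact: Cu.
by apply: commrV; apply: Cu.
Qed.

Lemma casimirE : Cas = \sum_(i < \dim {: subvs_of h}) H hbasis`_i * H (hdual i) +
  \sum_(b <- Dp) H (hv b) + (\sum_(b <- Dp) F b * E b) *+ 2.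
Proof.
rewrite /casimir big_dual_pairs !rmorphD !rmorph_sum -addrA; congr (_ + _).
  by apply: eq_bigr => i _; rewrite rmorphM.
have -> : \sum_(b <- Dp) j (iota (e b) * iota (f b)) =
    \sum_(b <- Dp) H (hv b) + \sum_(b <- Dp) F b * E b.
  rewrite -big_split; apply: eq_big_seq => b bD /=.
  by rewrite rmorphM (env_bracket (e b)) lie_ef // addrC.
rewrite -addrA; congr (_ + _); rewrite mulr2n; congr (_ + _).
by apply: eq_bigr => b _; rewrite rmorphM.
Qed.

(** On [vac] only the Cartan part of the Casimir survives, and [f_b] shifts it
    by [b]. *)
Lemma casimir_piece la m : verma_piece la m -> Cas *: m = hsum la *: m.
Proof.
elim=> {la m} [phi phih|la m b bD _ IH|la m n _ IHm _ IHn|la].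
- have Uh_sum : U'h (hsum (0 : wt)).
    apply: U'D; apply: big_ind => [|x y|i _]; try exact: U'h0; try exact: U'D.
      by apply: U'M; apply: U'D; try exact: U'h_gen; exact: U'h_scalar.
    by apply: U'D; [exact: U'h_gen | exact: U'h_scalar].
  rewrite !scalerA (casimir_commU' phih) (U'C Uh_sum phih) -!scalerA; congr (_ *: _).
  rewrite casimirE scalerDl [X in _ + X](_ : _ = 0) ?addr0; last first.
    have -> : (\sum_(b <- Dp) F b * E b) *+ 2 *: vac = (\sum_(b <- Dp) F b * E b) *: vac *+ 2.
      by rewrite !mulr2n scalerDl.
    rewrite scaler_suml big_seq big1 ?mul0rn // => b bD.
    by rewrite -scalerA e_vac // scaler0.
  congr (_ *: _); congr (_ + _); apply: eq_bigr => i _;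
    by rewrite !zero_lfunE !scale0r !addr0.
- rewrite scalerA casimir_comm -scalerA IH !scalerA; congr (_ *: _).
  have HF a : F b * (H a + (la a : K)%:A) = (H a + ((la + b) a : K)%:A) * F b.
    rewrite add_lfunE mulrDr (mulrDl (H a)) f_intertwine //; last exact: U'h_gen.
    rewrite (shift_gen (shiftP _)) opp_lfunE scaleNr mulrBr scalerDl mulrDl.
    by rewrite -!(scalarr_comm _ (F b)) [RHS]addrCA subrK addrC.
  rewrite mulrDr mulrDl mulr_sumr mulr_suml mulr_sumr mulr_suml; congr (_ + _).
    by apply: eq_bigr => i _; rewrite mulrA HF -!mulrA HF.
  by apply: eq_bigr => c _; rewrite HF.
- by rewrite !scalerDr IHm IHn.
- by rewrite !scaler0.
Qed.

Lemma hsumE (la : wt) : hsum la = \sum_(i < \dim {: subvs_of h}) H hbasis`_i * H (hdual i) +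
  \sum_(b <- Dp) H (hv b) + dpsi la *+ 2.
Proof.
have expand : \sum_(i < \dim {: subvs_of h})
    (H hbasis`_i + (la hbasis`_i : K)%:A) * (H (hdual i) + (la (hdual i) : K)%:A) =
    \sum_(i < \dim {: subvs_of h}) H hbasis`_i * H (hdual i) +
    (H (hv la) *+ 2 + (ip la la)%:A).
  have d1 : \sum_(i < \dim {: subvs_of h}) (la hbasis`_i : K) *: H (hdual i) = H (hv la).
    rewrite [in RHS](hdual_expand (hv la)) !linear_sum.
    by apply: eq_bigr => i _; rewrite !linearZ hvP.
  have d2 : \sum_(i < \dim {: subvs_of h}) (la (hdual i) : K) *: H hbasis`_i = H (hv la).
    rewrite [in RHS](hbasis_expand (hv la)) !linear_sum.
    by apply: eq_bigr => i _; rewrite !linearZ hvP.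
  have d3 : \sum_(i < \dim {: subvs_of h}) (la hbasis`_i : K) * la (hdual i) = ip la la.
    rewrite ip_eval [in RHS](hdual_expand (hv la)) !linear_sum.
    by apply: eq_bigr => i _; rewrite !linearZ hvP.
  rewrite mulr2n -{1}d1 -d2 -d3 scaler_suml -!big_split /=; apply: eq_bigr => i _.
  rewrite mulrDl !mulrDr mulr_algl mulr_algr mulr_algl scalerA.
  by rewrite -!addrA; congr (_ + _); rewrite addrCA.
have rho : \sum_(b <- Dp) (la (hv b) : K) = 2 * ip (half_sum Dp) la.
  rewrite (ip_eval (half_sum Dp)) /half_sum scale_lfunE sum_lfunE -[_ *: _]/(_ * _).
  rewrite mulrA divff ?pnatr_eq0 // mul1r; apply: eq_bigr => b _.
  by rewrite -!ip_eval ip_sym.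
have key : (ip la la)%:A + (2 * ip (half_sum Dp) la)%:A =
    (ip (half_sum Dp) la + 2^-1 * ip la la)%:A *+ 2 :> U'.
  by rewrite -scalerDl scalerMnl; congr (_%:A); field.
have shuffle (V : zmodType) (a s x u v : V) :
    a + (x + u) + (s + v) = a + s + (x + (u + v)).
  by rewrite -!addrA; congr (_ + _); rewrite [RHS]addrCA; congr (_ + _); rewrite addrCA.
rewrite expand big_split /= -scaler_suml rho /dpsi mulrnDl -key.
exact: shuffle.
Qed.

(** Subtract the Cartan part of [casimirE] from the eigenvalue given by
    [casimir_piece]. *)
Lemma omega_piece la m : verma_piece la m ->
  \sum_(b <- Dp) (F b * E b) *: m = dpsi la *: m.
Proof.
move=> mP; have xy : (\sum_(b <- Dp) F b * E b) *+ 2 *: m = dpsi la *+ 2 *: m.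
  by have := casimir_piece mP; rewrite casimirE hsumE 2!(scalerDl m (_ + _)) => /addrI.
have two : (2^-1 : K)%:A * 2%:R = 1 :> U'.
  by rewrite mulr_algl -(scaler_nat 2 (1 : U')) scalerA mulVf ?pnatr_eq0 // scale1r.
have half (z : U') : z = (2^-1 : K)%:A * (z *+ 2).
  by rewrite -(mulr_natl z 2) mulrA two mul1r.
by rewrite -scaler_suml (half (\sum_(b <- Dp) _)) (half (dpsi la)) -!scalerA xy.
Qed.

(** * The expansion of the projector *)

Local Notation word := (fe_word (fun b => E b) (fun b => F b)).
Local Notation eword s := (\prod_(b <- rev s) E b).
Local Notation tuple_sum n G := (\sum_(t : n.-tuple Dp) G (map val t)).

Lemma eword_cons b s : eword (b :: s) = eword s * E b.
Proof. by rewrite rev_cons big_rcons. Qed.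

Lemma word_cons b s : word (b :: s) = F b * word s * E b.
Proof. by rewrite /fe_word eword_cons big_cons !mulrA. Qed.

Lemma word_nil : word [::] = 1.
Proof. by rewrite /fe_word !big_nil mulr1. Qed.

Lemma tuple_sum0 (G : seq wt -> M) : tuple_sum 0 G = G [::].
Proof.
rewrite (big_pred1 [tuple]) => [//|t].
by rewrite (tuple0 t); apply/esym/eqP.
Qed.

Lemma tuple_sumS n (G : seq wt -> M) :
  tuple_sum n.+1 G = \sum_(b <- Dp) tuple_sum n (fun t => G (b :: t)).
Proof. by rewrite big_tuple_cons big_seq_fsetE. Qed.

Lemma piece_eword la m (s : seq wt) : {subset s <= Dp} -> verma_piece la m ->
  verma_piece (la - wsum s) (eword s *: m).
Proof.
elim: s la m => [|b s IH] la m sD mP; first by rewrite !big_nil subr0 scale1r.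
rewrite eword_cons -scalerA big_cons opprD addrA; apply: IH.
  by move=> c cs; apply: sD; rewrite inE cs orbT.
by apply: piece_e => //; apply: sD; rewrite mem_head.
Qed.

Lemma eword_nilpotent la m : verma_piece la m -> exists N, forall s : seq wt,
  {subset s <= Dp} -> (N < size s)%N -> eword s *: m = 0.
Proof.
move=> mP; case: (piece_cone mP) => [->|laP].
  by exists 0%N => s _ _; rewrite scaler0.
have [N NP] := nat_cone_bound laP; exists N => s sD Ns.
case: (piece_cone (piece_eword sD mP)) => // /(NP s sD).
by rewrite leqNgt Ns.
Qed.

Lemma subset_map_val n (t : n.-tuple Dp) : {subset map val t <= Dp}.
Proof. by move=> _ /mapP[x _ ->]; apply: fsvalP. Qed.

Lemma shift_delta la mu : shift la (delta mu) = delta mu.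
Proof. exact: (shift_nat (shiftP la)). Qed.

Lemma delta_psi_dpsi mu : ncone mu -> (delta mu - 1) * psi mu * dpsi mu = delta mu - 1.
Proof.
move=> muD; have [->|/eqP mu0] := eqVneq mu 0.
  by rewrite delta_in ?subrr ?mul0r //; exact: nat_cone0.
by rewrite mulrVK //; apply: dpsi_unit.
Qed.

Lemma U'h_delta1 la : U'h (delta la - 1).
Proof. by apply: U'D; [exact: U'h_delta | apply/U'N/U'h1]. Qed.

Lemma shift_delta1 la mu phi : U'h phi ->
  shift la ((delta mu - 1) * phi) = (delta mu - 1) * shift la phi.
Proof.
move=> phih; rewrite (shift_mul (shiftP la)) //; last exact: U'h_delta1.
rewrite (shiftB iota_comm U'_loc (shiftP la)) ?shift_delta ?(shift_one (shiftP la)) //.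
  exact: U'h_delta.
exact: U'h1.
Qed.

(** The letter [be] need not be a root: adding the next letter to it, as the
    recursion for the coefficients does, keeps the statement within itself. *)
Lemma word_sum_piece N be mu m :
  nat_cone_pos Dp be -> verma_piece mu m ->
  (forall s, {subset s <= Dp} -> size s = N -> eword s *: m = 0) ->
  \sum_(n < N) tuple_sum n (fun t => (shift (- be) (coef (be :: t)) * word t) *: m) =
  ((delta (be + mu) - 1) * shift (- be) (psi (be + mu))) *: m.
Proof.
elim: N be mu m => [|N IH] be mu m beP mP nil.
  have -> : m = 0 by have := nil [::]; rewrite big_nil scale1r; apply.
  by rewrite big_ord0 scaler0.
have [->|mu_cone] := piece_cone mP.
  rewrite scaler0 big1 // => n _; rewrite big1 // => t _; exact: scaler0.
rewrite big_ord_recl (tuple_sum0 (fun t => (shift (- be) (coef (be :: t)) * word t) *: m)).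
rewrite word_nil mulr1.
set p := shift (- be) (psi be); set q := shift (- be) (psi (be + mu)).
have ph : U'h p by apply/U'h_shift/U'h_psi.
have qh : U'h q by apply/U'h_shift/U'h_psi.
pose A := - p * ((delta (be + mu) - 1) * q) + delta be * p * ((delta mu - 1) * psi mu).
(* Peel off the first letter [b]: the two terms of the recursion are governed by
   the induction hypothesis at [be + b] and at [b]. *)
have sum_b b : b \in Dp ->
    \sum_(n < N) tuple_sum n (fun t =>
      (shift (- be) (coef [:: be, b & t]) * word (b :: t)) *: m) =
    A *: ((F b * E b) *: m).
  move=> bD; set m' := E b *: m.
  have m'P : verma_piece (mu - b) m' by exact: piece_e.
  have m'nil s : {subset s <= Dp} -> size s = N -> eword s *: m' = 0.
    move=> sD sN; rewrite /m' scalerA -eword_cons; apply: nil; last by rewrite /= sN.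
    by move=> c; rewrite inE => /orP[/eqP->|/sD].
  have bebP : nat_cone_pos Dp (be + b) by apply: nat_cone_posD => //; exact: nat_cone_mem.
  have term t : (shift (- be) (coef [:: be, b & t]) * word (b :: t)) *: m =
      (- p * F b) *: ((shift (- (be + b)) (coef (be + b :: t)) * word t) *: m') +
      (delta be * p * F b) *: ((shift (- b) (coef (b :: t)) * word t) *: m').
    have c1h := U'h_coef (be + b :: t); have c2h := U'h_coef (b :: t).
    have dph : U'h (delta be * psi be) by apply: U'M; [exact: U'h_delta | exact: U'h_psi].
    have nph : U'h (- psi be) by apply/U'N/U'h_psi.
    rewrite coef_cons (shift_add (shiftP _)); last 2 first.
      - exact: U'M.
      - by apply: U'M => //; exact: U'h_shift.
    rewrite !(shift_mul (shiftP _)) ?shift_delta ?(shiftN (shiftP _)) //; try exact: U'h_psi;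
      try exact: U'h_delta; try exact: U'h_shift.
    rewrite shift_shift // addNr shift_at0 // -/p /m' !scalerA -scalerDl; congr (_ *: _).
    rewrite word_cons !mulrA -!mulrDl; congr (_ * _ * _ * _).
    have c1sh : U'h (shift (- be) (coef (be + b :: t))) by exact: U'h_shift.
    rewrite mulrDl -(mulrA (- p) _ (F b)) (f_intertwine bD c1sh).
    rewrite -(mulrA (delta be * p) _ (F b)) (f_intertwine bD c2h).
    by rewrite shift_shift // -opprD [b + be]addrC !mulrA.
  under eq_bigr => n _ do under eq_bigr => t _ do rewrite term.
  under eq_bigr => n _ do rewrite big_split -!scaler_sumr.
  rewrite big_split -!scaler_sumr /= (IH _ (mu - b)) //.
  rewrite (IH _ (mu - b)) //; last exact: pos_root_cone.
  have -> : be + b + (mu - b) = be + mu by rewrite addrACA subrr addr0.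
  have -> : b + (mu - b) = mu by rewrite addrC subrK.
  have dqh : U'h ((delta (be + mu) - 1) * q) by apply: U'M => //; exact: U'h_delta1.
  have dph : U'h ((delta mu - 1) * psi mu) by apply: U'M; [exact: U'h_delta1 | exact: U'h_psi].
  have mv1 : F b * ((delta (be + mu) - 1) * shift (- (be + b)) (psi (be + mu))) =
      (delta (be + mu) - 1) * q * F b.
    rewrite (f_intertwine bD dqh) shift_delta1 // /q shift_shift; last exact: U'h_psi.
    by rewrite -opprD (addrC b).
  have mv2 : F b * ((delta mu - 1) * shift (- b) (psi mu)) =
      (delta mu - 1) * psi mu * F b.
    by rewrite (f_intertwine bD dph) shift_delta1 //; exact: U'h_psi.
  rewrite -(scalerA (F b)) -/m'; clearbody m'.
  by rewrite !scalerA -!mulrA mv1 mv2 -scalerDl /A (mulrDl _ _ (F b)) !mulrA.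
pose G t := (shift (- be) (coef (be :: t)) * word t) *: m.
rewrite [X in _ + X](_ : _ = \sum_(n < N) \sum_(b <- Dp)
  tuple_sum n (fun t => G (b :: t))); last first.
  by apply: eq_bigr => n _; exact: (tuple_sumS n G).
rewrite exchange_big /= (eq_big_seq _ sum_b) -scaler_sumr (omega_piece mP).
rewrite scalerA -scalerDl; congr (_ *: _).
have qC : p * q * dpsi mu = p - q by exact: psi_cancel.
have -> : A * dpsi mu = - p * (delta (be + mu) - 1) * q * dpsi mu +
    delta be * p * (delta mu - 1).
  by rewrite /A (mulrDl _ _ (dpsi mu)) -(mulrA (delta be * p)) delta_psi_dpsi // !mulrA.
have -> : shift (- be) (coef [:: be]) = (delta be - 1) * p.
  by rewrite coef1 [- 1 + _]addrC shift_delta1 //; exact: U'h_psi.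
have face := levi_cone_face PilP beP.1 mu_cone.
have [beL|beL] := EM (lcone be); last first.
  rewrite (delta_out (la := be + mu)) => [|/face[]//].
  by rewrite (delta_out beL) !sub0r mulrN1 opprK qC !mul0r addr0 !mulN1r addKr.
have [muL|muL] := EM (lcone mu); last first.
  rewrite (delta_out (la := be + mu)) => [|/face[]//].
  rewrite (delta_out muL) (delta_in beL) !sub0r subrr mul0r add0r mulrN1 opprK qC.
  by rewrite mul1r mulrN1 mulN1r addrAC subrr add0r.
rewrite (delta_in beL) (delta_in muL) (delta_in (la := be + mu)); last exact/face.
by rewrite subrr !mulr0 !mul0r !addr0.
Qed.

Variable P : M -> M.
Hypothesis P_proj : relative_extremal_projector iota j ract Dp Dpl P.

Lemma proj_piece la m : verma_piece la m -> P m = delta la *: m.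
Proof.
move=> mP; have mw := piece_weight mP.
have [laL|laL] := EM (lcone la).
  by rewrite (delta_in laL) scale1r; apply: (proj_id P_proj laL).
rewrite (delta_out laL) scale0r; case: (piece_cone mP) => [->|laD].
  by apply: (addrI (P 0)); rewrite -(proj_add P_proj) !addr0.
exact: (proj_zero P_proj laD laL).
Qed.

Lemma word_eq0 (s : seq wt) (m : M) : eword s *: m = 0 -> (coef s * word s) *: m = 0.
Proof. by move=> s0; rewrite /fe_word mulrA -scalerA s0 scaler0. Qed.

Lemma expansion_piece la m : verma_piece la m -> exists N0, forall N, (N0 <= N)%N ->
  (forall n, (N < n)%N -> forall t : n.-tuple Dp,
     (coef (map val t) * word (map val t)) *: m = 0) /\
  P m = m + \sum_(1 <= n < N.+1) tuple_sum n (fun t => (coef t * word t) *: m).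
Proof.
move=> mP; have [N0 nil] := eword_nilpotent mP; exists N0 => N N0N; split.
  move=> n Nn t; apply/word_eq0/nil; first exact: subset_map_val.
  by rewrite size_map size_tuple (leq_ltn_trans N0N).
rewrite (proj_piece mP) big_add1 big_mkord.
have [->|laD] := piece_cone mP.
  rewrite scaler0 add0r big1 // => n _; rewrite big1 // => t _; exact: scaler0.
pose G t := (coef t * word t) *: m.
rewrite (eq_bigr (fun n : 'I_N => \sum_(b <- Dp) tuple_sum n (fun t => G (b :: t)))); last first.
  by move=> n _; exact: (tuple_sumS n G).
rewrite exchange_big /=.
have dpsih : U'h ((delta la - 1) * psi la) by apply: U'M; [exact: U'h_delta1 | exact: U'h_psi].
(* For [b] fixed, [f_b] is moved to the left of the coefficients. *)
have sum_b b : b \in Dp -> \sum_(n < N) tuple_sum n (fun t => G (b :: t)) =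
    ((delta la - 1) * psi la) *: ((F b * E b) *: m).
  move=> bD; have m'P := piece_e bD mP; have bP := pos_root_cone bD.
  have m'nil s : {subset s <= Dp} -> size s = N -> eword s *: (E b *: m) = 0.
    move=> sD sN; rewrite scalerA -eword_cons; apply: nil; last by rewrite /= sN.
    by move=> c; rewrite inE => /orP[/eqP->|/sD].
  have GE t : G (b :: t) = F b *: ((shift (- b) (coef (b :: t)) * word t) *: (E b *: m)).
    rewrite /G word_cons !scalerA !mulrA; congr (_ *: _).
    by rewrite (f_intertwine bD (U'h_coef _)).
  under eq_bigr => n _ do under eq_bigr => t _ do rewrite GE.
  under eq_bigr => n _ do rewrite -scaler_sumr.
  rewrite -scaler_sumr (word_sum_piece bP m'P m'nil).
  have -> : b + (la - b) = la by rewrite addrC subrK.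
  rewrite !scalerA !mulrA (f_intertwine bD dpsih) shift_delta1; last exact: U'h_psi.
  by rewrite !mulrA.
rewrite (eq_big_seq _ sum_b) -scaler_sumr (omega_piece mP) scalerA delta_psi_dpsi //.
by rewrite scalerBl scale1r addrCA subrr addr0.
Qed.

Lemma expansion m : exists N,
  (forall n, (N < n)%N -> forall t : n.-tuple Dp,
     (coef (map val t) * word (map val t)) *: m = 0) /\
  P m = m + \sum_(1 <= n < N.+1) tuple_sum n (fun t => (coef t * word t) *: m).
Proof.
pose good m := exists N0, forall N, (N0 <= N)%N ->
  (forall n, (N < n)%N -> forall t : n.-tuple Dp,
     (coef (map val t) * word (map val t)) *: m = 0) /\
  P m = m + \sum_(1 <= n < N.+1) tuple_sum n (fun t => (coef t * word t) *: m).
suff [N0 /(_ N0 (leqnn _)) mE] : good m by exists N0.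
apply: (verma_piece_sum (Q := good)) => [|m1 m2 [N1 g1] [N2 g2]|la m' m'P].
- exact: expansion_piece (piece_zero 0).
- exists (maxn N1 N2) => N; rewrite geq_max => /andP[/g1[v1 s1] /g2[v2 s2]]; split.
    by move=> n Nn t; rewrite scalerDr v1 // v2 // addr0.
  rewrite (proj_add P_proj) s1 s2 addrACA -big_split /=; congr (_ + _).
  apply: eq_bigr => n _; rewrite -big_split; apply: eq_bigr => t _ /=.
  by rewrite scalerDr.
- exact: expansion_piece m'P.
Qed.

End ExtremalProjector.

Theorem theorem1p1 (R : realType) (g : vectType R[i])
  (lie : {bilinear g -> g -> g}) (lieP : is_lie_bracket lie)
  (g_reductive : reductive lie)
  (B : {symmetric g}) (BP : invariant_nondegenerate lie B)
  (h : {vspace g}) (h_cartan : cartan_subalgebra lie h)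
  (Dp : {fset (weight h)}) (DpP : positive_system lie Dp)
  (e f : weight h -> g) (efP : root_vectors lie B Dp e f)
  (hv : weight h -> subvs_of h) (hvP : is_coroot_map B hv)
  (Pil : {fset (weight h)})
  (PilP : forall al, al \in Pil -> simple_root Dp al)
  (l : {vspace g}) (lP : l = levi_subalgebra Dp e f Pil)
  (U : algType R[i]) (iota : {linear g -> U})
  (U_env : enveloping_algebra lie iota)
  (U' : unitAlgType R[i]) (j : {lrmorphism U -> U'})
  (U'_loc : ore_localization (in_S h iota) j)
  (shift : weight h -> U' -> U')
  (shiftP : forall la, is_shift iota j la (shift la))
  (M : lmodType U') (vac : M) (ract : M -> U' -> M)
  (M_verma : universal_verma lie iota j Dp vac ract)
  (P : M -> M)
  (P_proj :
    relative_extremal_projector iota j ract Dp (levi_roots Dp Pil) P) :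
  let Dpl := levi_roots Dp Pil in
  let psi_ := psi B iota j Dp hv in
  let coef := proj_coef Dpl psi_ shift in
  let word := fe_word (fun b => j (iota (e b))) (fun b => j (iota (f b))) in
  [/\ forall m : M, exists N : nat,
        (forall n, (N < n)%N -> forall b : n.-tuple Dp,
           (coef (map val b) * word (map val b)) *: m = 0) /\
        P m = m + \sum_(1 <= n < N.+1) \sum_(b : n.-tuple Dp)
                    (coef (map val b) * word (map val b)) *: m,
      forall s : seq (weight h), (0 < size s)%N ->
        (forall b, b \in s -> nat_cone_pos Dp b) ->
        in_U'h h iota j (coef s),
      forall s : seq (weight h), (0 < size s)%N ->
        (forall b, b \in s -> nat_cone_pos Dp b) ->
        (forall b, b \in s -> nat_cone Dpl b) ->
        coef s = 0
    & forall (s : seq (weight h)) (m : nat),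
        (forall b, b \in s -> nat_cone_pos Dp b) ->
        (0 < m <= size s)%N ->
        (forall i, (i < m.-1)%N -> nat_cone Dpl s`_i) ->
        ~ nat_cone Dpl s`_m.-1 ->
        coef s = \sum_(0 <= k < m) closed_term psi_ shift s k].
Proof.
move=> Dpl psi_ coef word; split.
- move=> m; exact: (expansion lieP g_reductive BP h_cartan DpP efP hvP U_env
    U'_loc shiftP PilP M_verma P_proj m).
- move=> s _ _; exact: (U'h_coef B h_cartan Dp hv U_env U'_loc shiftP Pil s).
- move=> s s0 _ sL; exact: (coef_levi B hv shiftP s0 sL).
- move=> s m sP ms sL mL; exact: (coef_closed lieP g_reductive BP h_cartan DpP efP
    hvP U_env U'_loc shiftP PilP sP ms sL mL).
Qed.
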